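(* Let $K$ be a perfect field, $R$ a $K$-algebra, and $J$ an ideal of $R$. If $J$ and $R/J$ are both locally f.d.ss $K$-algebras, then $R$ is locally f.d.ss.
   Context: A field $K$ is perfect if every algebraic extension of $K$ is separable. All algebras are associative but not necessarily unital $K$-algebras; ideals are two-sided ring ideals that are also $K$-subspaces. A $K$-algebra $R$ is locally f.d.ss (locally finite dimensional semisimple) if every finite subset of $R$ is contained in a subalgebra of $R$ that is a finite dimensional semisimple $K$-algebra. *)

(* Defs.v *)
From HB Require Import structures.
From mathcomp Require Import all_boot all_order all_algebra all_field.
Set Implicit Arguments. Unset Strict Implicit. Unset Printing Implicit Defensive.
Import GRing.Theory.
Local Open Scope ring_scope.

(* A field K is perfect if every algebraic extension of K is separable.
   Every algebraic extension is the union of its finite subextensions, so this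
   is literally the statement that every finite field extension L/K
   (a [fieldExtType K]) is separable over K. *)
Definition perfect_field (K : fieldType) : Prop :=
  forall L : fieldExtType K, separable (1%VS : {vspace L}) fullv.

Record nalgType (K : fieldType) := NAlgType {
  nalg_sort :> lmodType K;
  nmul : nalg_sort -> nalg_sort -> nalg_sort;
  nmulA : associative nmul;
  nmulDl : left_distributive nmul +%R;
  nmulDr : right_distributive nmul +%R;
  nmulZl : forall (a : K) x y, nmul (a *: x) y = a *: nmul x y;
  nmulZr : forall (a : K) x y, nmul x (a *: y) = a *: nmul x y
}.
Arguments nmul {K} R x y : rename.

Section Defs.
Variables (K : fieldType) (R : nalgType K).

Definition is_subspace (S : R -> Prop) : Prop :=
  [/\ S 0, (forall x y, S x -> S y -> S (x + y)) &
      (forall (a : K) x, S x -> S (a *: x))].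

Definition is_subalg (S : R -> Prop) : Prop :=
  is_subspace S /\ (forall x y, S x -> S y -> S (nmul R x y)).

Definition is_ideal_in (A I : R -> Prop) : Prop :=
  [/\ is_subspace I, (forall x, I x -> A x),
      (forall a x, A a -> I x -> I (nmul R a x)) &
      (forall a x, A a -> I x -> I (nmul R x a))].

Definition is_ideal (I : R -> Prop) : Prop := is_ideal_in (fun _ => True) I.

Definition nprod (x : R) (s : seq R) : R := foldl (nmul R) x s.

Definition nilpotent_set (I : R -> Prop) : Prop :=
  exists n : nat, forall (x : R) (s : seq R),
    size s = n -> I x -> (forall y, y \in s -> I y) -> nprod x s = 0.

Definition in_span (s : seq R) (x : R) : Prop :=
  exists c : 'I_(size s) -> K, x = \sum_(i < size s) c i *: s`_i.

Definition fin_dim (S : R -> Prop) : Prop :=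
  exists s : seq R, forall x, S x <-> in_span s x.

(* S (a subalgebra) is semisimple: its (Wedderburn/Jacobson) radical is 0,
   i.e. S has no nonzero nilpotent two-sided ideal *)
Definition semisimple_sub (S : R -> Prop) : Prop :=
  forall I, is_ideal_in S I -> nilpotent_set I -> forall x, I x -> x = 0.

Definition fdss_subalg (S : R -> Prop) : Prop :=
  [/\ is_subalg S, fin_dim S & semisimple_sub S].

Definition locally_fdss_in (A : R -> Prop) : Prop :=
  forall s : seq R, (forall x, x \in s -> A x) ->
    exists S : R -> Prop,
      [/\ fdss_subalg S, (forall x, S x -> A x) & (forall x, x \in s -> S x)].

Definition locally_fdss : Prop := locally_fdss_in (fun _ => True).

End Defs.

Definition nalg_hom (K : fieldType) (R Q : nalgType K) (f : R -> Q) : Prop :=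
  [/\ forall x y, f (x + y) = f x + f y,
      forall (a : K) x, f (a *: x) = a *: f x &
      forall x y, f (nmul R x y) = nmul Q (f x) (f y)].

(* Main.v *)
Require Import Defs.
From HB Require Import structures.
From mathcomp Require Import all_boot all_order all_algebra all_field.
From Stdlib Require Import Classical.
Set Implicit Arguments. Unset Strict Implicit. Unset Printing Implicit Defensive.
Import GRing.Theory.
Local Open Scope ring_scope.

(** Let [S] be a finite-dimensional semisimple subalgebra of [R/J] containing the
    images of the given elements, with basis lifted to [r_1, ..., r_n] in [R].
    Finitely many elements of [J] generate a subalgebra [N], stable under the
    [r_i], modulo which the span of the [r_i] is closed under products and
    contains the given elements. Embed [N] in a finite-dimensional semisimple
    subalgebra of [J], with unit [e]. As [K] is perfect, [S] has a separability
    idempotent; averaging [e] with it gives [g] in [J] which acts as the identity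
    on [N] and commutes with the [r_i] modulo [N]. Then [q = 2g - g^2] commutes
    with the [r_i] exactly, and so does a suitable idempotent [p] in [K[q]],
    which still acts as the identity on [N]. If [T] is a finite-dimensional
    semisimple subalgebra of [J] containing [p], the [r_i p] and [N], the corner
    [p T p] is stable under the [r_i], and the span of the [r_i] plus [p T p] is
    the required subalgebra.

    The separability idempotent exists because [S (x) S^op] is semisimple: a
    nonzero ideal of it meets [Z(S) (x) Z(S)], whose elements become
    simultaneously diagonalizable over a splitting field, so it is not nil.

    Semisimplicity is used in the form "[x S x = 0] implies [x = 0]". *)

(** * Finite-dimensional semiprime algebras *)

(** The product is a bare function on a module, so that one set of lemmas serves [nmul R],
    coordinate products on ['rV[K]_n], opposite products and [tmul]. *)
Record alg_law (K : fieldType) (V : lmodType K) (mul : V -> V -> V) : Prop :=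
  AlgLaw {
    alg_mulA : associative mul;
    alg_mulDl : left_distributive mul +%R;
    alg_mulDr : right_distributive mul +%R;
    alg_mulZl : forall (a : K) x y, mul (a *: x) y = a *: mul x y;
    alg_mulZr : forall (a : K) x y, mul x (a *: y) = a *: mul x y }.

Definition semiprime (V : zmodType) (mul : V -> V -> V) : Prop :=
  forall x, (forall t, mul (mul x t) x = 0) -> x = 0.

Section AlgLaw.
Variables (K : fieldType) (V : lmodType K) (mul : V -> V -> V).
Hypothesis mulP : alg_law mul.

Lemma alg_linearl a : linear (mul a).
Proof. by move=> k x y; rewrite (alg_mulDr mulP) (alg_mulZr mulP). Qed.

Lemma alg_linearr a : linear (mul^~ a).
Proof. by move=> k x y; rewrite /= (alg_mulDl mulP) (alg_mulZl mulP). Qed.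

Lemma alg_mul0 a : mul a 0 = 0.
Proof. by have := alg_mulZr mulP 0 a 0; rewrite !scale0r. Qed.

Lemma alg_0mul a : mul 0 a = 0.
Proof. by have := alg_mulZl mulP 0 0 a; rewrite !scale0r. Qed.

Lemma alg_mulN a b : mul a (- b) = - mul a b.
Proof. by rewrite -scaleN1r (alg_mulZr mulP) scaleN1r. Qed.

Lemma alg_Nmul a b : mul (- a) b = - mul a b.
Proof. by rewrite -scaleN1r (alg_mulZl mulP) scaleN1r. Qed.

Lemma alg_mulB a b c : mul a (b - c) = mul a b - mul a c.
Proof. by rewrite (alg_mulDr mulP) alg_mulN. Qed.

Lemma alg_Bmul a b c : mul (a - b) c = mul a c - mul b c.
Proof. by rewrite (alg_mulDl mulP) alg_Nmul. Qed.

Lemma alg_mul_suml I (r : seq I) (F : I -> V) a :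
  mul (\sum_(i <- r) F i) a = \sum_(i <- r) mul (F i) a.
Proof.
apply: (big_morph (mul^~ a)) => [x y|]; [exact: alg_mulDl mulP _ _ _ | exact: alg_0mul].
Qed.

Lemma alg_mul_sumr I (r : seq I) (F : I -> V) a :
  mul a (\sum_(i <- r) F i) = \sum_(i <- r) mul a (F i).
Proof.
apply: (big_morph (mul a)) => [x y|]; [exact: alg_mulDr mulP _ _ _ | exact: alg_mul0].
Qed.

Lemma alg_law_op : alg_law (fun x y => mul y x).
Proof.
by case: mulP => mA mDl mDr mZl mZr; split=> // x y z; rewrite mA.
Qed.

Lemma semiprime_op : semiprime mul -> semiprime (fun x y => mul y x).
Proof. by move=> sp x x0; apply: sp => t; rewrite -(alg_mulA mulP). Qed.

End AlgLaw.

(** Classical: as long as some vector satisfying [P] lies outside [U], it is added to [U]; the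
    codimension bounds the number of such additions. *)
Lemma vspace_of_pred (K : fieldType) (V : vectType K) (P : V -> Prop) :
    P 0 -> (forall x y, P x -> P y -> P (x + y)) ->
    (forall (a : K) x, P x -> P (a *: x)) ->
  exists U : {vspace V}, forall x, P x <-> x \in U.
Proof.
move=> P0 PD PZ.
have grow k (U : {vspace V}) : (\dim {:V} - \dim U <= k)%N ->
    (forall x, x \in U -> P x) -> exists W : {vspace V}, forall x, P x <-> x \in W.
  elim: k U => [|k IH] U dimU UP.
    have UT : U = fullv.
      by apply/eqP; rewrite eqEdim subvf -subn_eq0 -leqn0.
    by exists U => x; split=> [_|]; [rewrite UT memvf | apply: UP].
  have [[x [Px Ux]]|nex] := classic (exists x, P x /\ x \notin U).
    apply: (IH (U + <[x]>)%VS); last first.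
      move=> y /memv_addP[u Uu [_ /vlineP[c ->] ->]].
      by apply: PD; [apply: UP | apply: PZ].
    have lt_dim : (\dim U < \dim (U + <[x]>))%N.
      rewrite ltn_neqAle dimvS ?addvSl // andbT; apply/negP => /eqP eqd.
      have /eqP eqU : U == (U + <[x]>)%VS by rewrite eqEdim addvSl -eqd leqnn.
      have : x \in (U + <[x]>)%VS by apply: subvP (addvSr _ _) _ (memv_line x).
      by rewrite -eqU (negPf Ux).
    have := dimvS (subvf (U + <[x]>)); move: dimU lt_dim.
    rewrite !leq_subLR => h1 h2 _; apply: leq_trans h1 _.
    by rewrite addnS -addSn leq_add2r.
  exists U => x; split=> [Px|]; last exact: UP.
  by apply: NNPP => Ux; apply: nex; exists x; split=> //; apply/negP.
by apply: (grow _ 0%VS (leqnn _)) => x; rewrite memv0 => /eqP->.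
Qed.

(** * Idempotents and units in one-sided ideals *)

Section FiniteDimensional.
Variables (K : fieldType) (V : vectType K) (mul : V -> V -> V).
Hypotheses (mulP : alg_law mul) (spV : semiprime mul).
Local Notation "x ** y" := (mul x y) (at level 40, left associativity).
Let mA := alg_mulA mulP.

Definition left_ideal (L : {vspace V}) := forall a x, x \in L -> a ** x \in L.
Definition right_ideal (L : {vspace V}) := forall a x, x \in L -> x ** a \in L.

(** Brauer's argument. In a minimal [L], take [x t x] nonzero and put [a = t x]. Minimality gives
    [L a = L] and a zero left annihilator of [a] in [L]. Hence [a = e a] for some [e] in [L], and
    [e - e e], which kills [a], vanishes. *)
Lemma left_ideal_idempotent (L : {vspace V}) : left_ideal L -> L != 0%VS ->
  exists e, [/\ e \in L, e != 0 & e ** e = e].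
Proof.
have [k] := ubnP (\dim L); elim: k L => // k IH L; rewrite ltnS => dimL idL nzL.
have [[L' [idL' nzL' sL ltL]]|minL] := classic (exists L' : {vspace V},
    [/\ left_ideal L', L' != 0%VS, (L' <= L)%VS & (\dim L' < \dim L)%N]).
  have [e [Le nze ee]] := IH L' (leq_trans ltL dimL) idL' nzL'.
  by exists e; split=> //; apply: subvP Le.
have Lx0 := memv_pick L; move: nzL; rewrite -vpick0; set x := vpick L in Lx0 *.
move=> nzx; have [[t nz_xtx]|nt] := classic (exists t, x ** t ** x != 0); last first.
  case/eqP: nzx; apply: spV => t; apply/eqP; apply: contraT => nz.
  by case: nt; exists t.
pose a := t ** x; have La : a \in L by apply: idL.
have nz_xa : x ** a != 0 by rewrite /a mA.
have nz_a : a != 0 by apply: contraNneq nz_xa => ->; rewrite (alg_mul0 mulP).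
have full_sub (L' : {vspace V}) :
    left_ideal L' -> (L' <= L)%VS -> L' != 0%VS -> L' = L.
  move=> idL' sL nzL'; apply/eqP; rewrite eqEdim sL leqNgt; apply/negP => ltL.
  by apply: minL; exists L'.
have [La' La'P] : exists U : {vspace V},
    forall z, (exists2 y, y \in L & z = y ** a) <-> z \in U.
  apply: vspace_of_pred.
  - by exists 0; rewrite ?mem0v ?(alg_0mul mulP).
  - move=> _ _ [y Ly ->] [z Lz ->]; exists (y + z); first exact: memvD.
    by rewrite (alg_mulDl mulP).
  - by move=> c _ [y Ly ->]; exists (c *: y); [apply: memvZ | rewrite (alg_mulZl mulP)].
have [An AnP] : exists U : {vspace V}, forall y, (y \in L /\ y ** a = 0) <-> y \in U.
  apply: vspace_of_pred.
  - by rewrite mem0v (alg_0mul mulP).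
  - by move=> y z [Ly y0] [Lz z0]; rewrite memvD // (alg_mulDl mulP) y0 z0 addr0.
  - by move=> c y [Ly y0]; rewrite memvZ // (alg_mulZl mulP) y0 scaler0.
have eqLa : La' = L.
  apply: full_sub.
  - move=> b _ /La'P[y Ly ->]; apply/La'P; exists (b ** y); first exact: idL.
    by rewrite mA.
  - by apply/subvP => _ /La'P[y Ly ->]; apply: idL.
  - apply: contraNneq nz_xa => La0; rewrite -memv0 -La0; apply/La'P.
    by exists x.
have An0 : An = 0%VS.
  apply/eqP; apply: contraT => nzAn; have eqAn : An = L.
    apply: full_sub => //; last by apply/subvP => y /AnP[].
    by move=> b y /AnP[Ly y0]; apply/AnP; rewrite -mA y0 (alg_mul0 mulP); split=> //; apply: idL.
  have /AnP[_ xa0] : x \in An by rewrite eqAn.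
  by rewrite xa0 eqxx in nz_xa.
have /La'P[e Le ae] : a \in La' by rewrite eqLa.
exists e; split=> //.
  by apply: contraNneq nz_a => e0; rewrite ae e0 (alg_0mul mulP).
apply/eqP; rewrite -subr_eq0 -memv0 -An0; apply/AnP; split.
  by rewrite memvB // idL.
by rewrite (alg_Bmul mulP) -mA -ae -ae subrr.
Qed.

(** Induction on the dimension of the left annihilator [An] in [L] of an idempotent [e], starting
    from [e = 0]. A nonzero [An] contains an idempotent [f]; replacing [e] by [e'] shrinks [An],
    since [f] leaves it. *)
Lemma left_ideal_unit (L : {vspace V}) : left_ideal L ->
  exists2 e, e \in L & forall x, x \in L -> x ** e = x.
Proof.
move=> idL.
have AnP e : exists U : {vspace V}, forall y, (y \in L /\ y ** e = 0) <-> y \in U.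
  apply: vspace_of_pred.
  - by rewrite mem0v (alg_0mul mulP).
  - by move=> y z [Ly y0] [Lz z0]; rewrite memvD // (alg_mulDl mulP) y0 z0 addr0.
  - by move=> c y [Ly y0]; rewrite memvZ // (alg_mulZl mulP) y0 scaler0.
suff IH k e (An : {vspace V}) : e \in L -> e ** e = e ->
    (forall y, (y \in L /\ y ** e = 0) <-> y \in An) -> (\dim An < k)%N ->
    exists2 e, e \in L & forall x, x \in L -> x ** e = x.
  by have [An AnE] := AnP 0; apply: (IH _ 0 An) (ltnSn _); rewrite ?mem0v ?(alg_0mul mulP).
elim: k e An => // k IH e An Le ee AnE; rewrite ltnS => dimAn.
have [An0|nzAn] := eqVneq An 0%VS.
  exists e => // x Lx; apply/esym/eqP; rewrite -subr_eq0 -memv0 -An0; apply/AnE.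
  by rewrite memvB ?idL // (alg_Bmul mulP) -mA ee subrr.
have idAn : left_ideal An.
  by move=> b y /AnE[Ly y0]; apply/AnE; rewrite -mA y0 (alg_mul0 mulP) idL.
have [f [/AnE[Lf fe] nzf ff]] := left_ideal_idempotent idAn nzAn.
(* Formally [1 - e' = (1 - e) (1 - f)]; as [f e = 0], this gives [e' e = e] and [f e' = f]. *)
pose e' := e + f - e ** f.
have ee'e : e' ** e = e.
  by rewrite /e' (alg_Bmul mulP) (alg_mulDl mulP) ee fe -mA fe (alg_mul0 mulP) subr0 addr0.
have fe' : f ** e' = f.
  by rewrite /e' (alg_mulB mulP) (alg_mulDr mulP) fe ff mA fe (alg_0mul mulP) subr0 add0r.
have ee' : e ** e' = e.
  by rewrite /e' (alg_mulB mulP) (alg_mulDr mulP) ee mA ee addrK.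
have e'e' : e' ** e' = e'.
  by rewrite {1}/e' (alg_Bmul mulP) (alg_mulDl mulP) -mA fe' ee'.
have Le' : e' \in L by rewrite memvB ?memvD ?idL.
have [An' An'E] := AnP e'.
apply: (IH e' An') => //; apply: leq_trans dimAn.
have sAn : (An' <= An)%VS.
  apply/subvP => y /An'E[Ly y0]; apply/AnE; split=> //.
  by rewrite -[e in LHS]ee'e mA y0 (alg_0mul mulP).
rewrite ltn_neqAle dimvS // andbT; apply/negP => /eqP eqd.
have /eqP eqAn : An' == An by rewrite eqEdim sAn eqd /=.
have /An'E[_] : f \in An' by rewrite eqAn; apply/AnE.
by rewrite fe'; move/eqP: nzf.
Qed.
End FiniteDimensional.

Section Ideals.
Variables (K : fieldType) (V : vectType K) (mul : V -> V -> V).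
Hypotheses (mulP : alg_law mul) (spV : semiprime mul).
Local Notation "x ** y" := (mul x y) (at level 40, left associativity).

(** A right unit [e] and a left unit [e'] of [I] satisfy [e' = e' e = e]. It is central because
    [a e] and [e a] lie in [I], so that both equal [e a e]. *)
Lemma ideal_unit (I : {vspace V}) : left_ideal mul I -> right_ideal mul I ->
  exists e, [/\ e \in I, forall x, x \in I -> e ** x = x /\ x ** e = x
               & forall a, a ** e = e ** a].
Proof.
move=> idL idR.
have [e Ie eR] := left_ideal_unit mulP spV idL.
have [e' Ie' eL] := left_ideal_unit (alg_law_op mulP) (semiprime_op mulP spV) idR.
have e'e : e' = e by rewrite -(eL e Ie) eR.
subst e'; exists e; split=> // [x Ix|a]; first by rewrite eL // eR.
by rewrite -(eL (a ** e)) ?idL // (alg_mulA mulP) eR // idR.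
Qed.

Lemma semiprime_unit : exists u, forall x, u ** x = x /\ x ** u = x.
Proof.
have [||u [_ uP _]] := @ideal_unit fullv; try by move=> *; apply: memvf.
by exists u => x; apply: uP; apply: memvf.
Qed.
End Ideals.

(** * Separable polynomials and splitting fields *)

Lemma irreducible_factor (K : fieldType) (p : {poly K}) : (1 < size p)%N ->
  exists2 q, irreducible_poly q & q %| p.
Proof.
have [k] := ubnP (size p); elim: k p => // k IH p; rewrite ltnS => szp p1.
have nzp : p != 0 by rewrite -size_poly_gt0 ltnW.
have [irr|/not_all_ex_not[q]] :=
  classic (forall q : {poly K}, size q != 1%N -> q %| p -> q %= p); first by exists p.
move=> H; have [q1 H1] := imply_to_and _ _ H; have [qp nqp] := imply_to_and _ _ H1.
have nzq : q != 0 by apply: contraTneq qp => ->; rewrite dvd0p.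
have szq : (1 < size q)%N by rewrite ltn_neqAle eq_sym q1 size_poly_gt0.
have ltq : (size q < size p)%N.
  rewrite ltn_neqAle dvdp_leq // andbT; apply/negP => /eqP eqs.
  by apply: nqp; rewrite -dvdp_size_eqp // eqs.
have [r irr_r rq] := IH q (leq_trans ltq szp) szq.
by exists r => //; apply: dvdp_trans rq qp.
Qed.

(** A root of an irreducible factor is adjoined and divided off, then the quotient is split over the
    larger field. Only a morphism out of [K] is kept, so the steps of the tower simply compose. *)
Lemma splitting_extension (K : fieldType) (p : {poly K}) : p != 0 ->
  exists (L : fieldType) (f : {rmorphism K -> L}) (c : L) (rs : seq L),
    map_poly f p = c *: \prod_(r <- rs) ('X - r%:P).
Proof.
have [k] := ubnP (size p).
elim: k K p => // k IH K' p; rewrite ltnS => szp nzp.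
have [p1|/size1_polyC ->] := ltnP 1 (size p); last first.
  exists K', (idfun : {rmorphism K' -> K'}), p`_0, [::].
  by rewrite big_nil map_polyC /= alg_polyC.
have [q irr_q qp] := irreducible_factor p1.
have [L _ [z rz _]] := irredp_FAdjoin irr_q.
have {rz} rz : root (map_poly (in_alg L) p) z.
  have /dvdpP[s ->] := qp; rewrite rmorphM rootM rz orbT //.
have /factor_theorem[p' Dp] := rz.
have nzmp : map_poly (in_alg L) p != 0 by rewrite map_poly_eq0.
have nzp' : p' != 0 by apply: contraNneq nzmp => p'0; rewrite Dp p'0 mul0r.
have szp' : (size p' < k)%N.
  apply: leq_trans szp; rewrite -(size_map_poly (in_alg L)) Dp.
  by rewrite size_Mmonic ?monicXsubC // size_XsubC addn2.
have [M [g [c [rs Dp']]]] := IH L p' szp' nzp'.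
exists M, (g \o in_alg L : {rmorphism K' -> M}), c, (g z :: rs).
rewrite map_poly_comp Dp rmorphM /= Dp' rmorphB /= map_polyX map_polyC /=.
by rewrite big_cons -scalerAl mulrC.
Qed.

Section Perfect.
Variable K : fieldType.
Implicit Types p q : {poly K}.

(** A root [z] of [p] in a finite extension has a minimal polynomial associated to [p]; if [p] had
    zero derivative, so would that polynomial, against separability of [z]. *)
Lemma perfect_irreducible_separable p : perfect_field K ->
  irreducible_poly p -> p^`() != 0.
Proof.
move=> perfK irr_p; have [L _ [z rz _]] := irredp_FAdjoin irr_p.
have /separableP/(_ z (memvf z)) := perfK L.
rewrite separable_nz_der; apply: contraNneq => p'0.
have /polyOver1P[q Dq] := minPolyOver 1 z.
have qp : q %| p.
  by rewrite -(dvdp_map (in_alg L)) -Dq minPoly_dvdp // alg_polyOver.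
have q1 : size q != 1%N.
  by rewrite -(size_map_poly (in_alg L)) -Dq size_minPoly.
have /eqpP[[a b] /= /andP[nza nzb] eqab] := irr_p.2 q q1 qp.
have /eqP := congr1 (@deriv K) eqab; rewrite !derivZ p'0 scaler0 scaler_eq0.
by rewrite (negPf nza) /= => /eqP q'0; rewrite Dq deriv_map q'0 rmorph0.
Qed.

(** Suppose a nonconstant divisor [u = q g], with [g] irreducible, has zero derivative.
    Squarefreeness makes [g] prime to [q], and [g] divides [q g'], hence [g'], which is nonzero of
    smaller degree. *)
Lemma perfect_squarefree_separable p : perfect_field K ->
  (forall u : {poly K}, size u != 1%N -> ~~ (u ^+ 2 %| p)) -> separable_poly p.
Proof.
move=> perfK /poly_square_freeP sqf; apply/separable_polyP; split=> // u up u1.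
have [g irr_g gu] := irreducible_factor u1.
have /dvdpP[q Dq] := gu; apply/negP => /eqP u'0.
have co : coprimep g q by apply: sqf; rewrite mulrC -Dq.
have gg' : g %| g^`().
  rewrite -(Gauss_dvdpr _ co) -(dvdp_addr _ (dvdp_mull q^`() (dvdpp g))).
  by rewrite -derivM -Dq u'0 dvdp0.
have nzg' := perfect_irreducible_separable perfK irr_g.
have := dvdp_leq nzg' gg'; rewrite leqNgt lt_size_deriv ?irredp_neq0 //.
Qed.
End Perfect.

(** * Left multiplication matrices *)

Definition lmx (K : fieldType) n (mul : 'rV[K]_n -> 'rV[K]_n -> 'rV[K]_n) a : 'M[K]_n :=
  lin1_mx (mul a).
Definition rmx (K : fieldType) n (mul : 'rV[K]_n -> 'rV[K]_n -> 'rV[K]_n) a : 'M[K]_n :=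
  lin1_mx (mul^~ a).

Lemma mul_rV_linear (K : fieldType) m n (f : 'rV[K]_m -> 'rV[K]_n) x :
  linear f -> x *m lin1_mx f = f x.
Proof.
move=> lf; pose F : {linear 'rV[K]_m -> 'rV[K]_n} :=
  HB.pack f (GRing.isLinear.Build _ _ _ _ f lf).
exact: (mul_rV_lin1 F).
Qed.

Lemma eq_mulrV (K : fieldType) m n (A B : 'M[K]_(m, n)) :
  (forall x : 'rV_m, x *m A = x *m B) -> A = B.
Proof. by move=> AB; apply/row_matrixP => i; rewrite !rowE AB. Qed.

Section MulMatrices.
Variables (K : fieldType) (n : nat) (mul : 'rV[K]_n -> 'rV[K]_n -> 'rV[K]_n).
Hypothesis mulP : alg_law mul.

Lemma mul_lmx a x : x *m lmx mul a = mul a x.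
Proof. exact/mul_rV_linear/(alg_linearl mulP). Qed.

Lemma mul_rmx a x : x *m rmx mul a = mul x a.
Proof. exact: mul_rV_linear (alg_linearr mulP a). Qed.

Lemma lmx_mul a b : lmx mul (mul a b) = lmx mul b *m lmx mul a.
Proof. by apply: eq_mulrV => x; rewrite mulmxA !mul_lmx (alg_mulA mulP). Qed.

Lemma lmx_rmxC a b : lmx mul a *m rmx mul b = rmx mul b *m lmx mul a.
Proof.
by apply: eq_mulrV => x; rewrite !mulmxA !(mul_lmx, mul_rmx) (alg_mulA mulP).
Qed.

Lemma lmx_sum a : lmx mul a = \sum_i a 0 i *: lmx mul (delta_mx 0 i).
Proof.
apply: eq_mulrV => x; rewrite mul_lmx {1}[a]row_sum_delta (alg_mul_suml mulP).
rewrite mulmx_sumr; apply: eq_bigr => i _.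
by rewrite (alg_mulZl mulP) -scalemxAr mul_lmx.
Qed.

End MulMatrices.

Lemma lmx_unit (K : fieldType) n (mul : 'rV[K]_n -> 'rV[K]_n -> 'rV[K]_n) u :
  alg_law mul -> (forall x, mul u x = x) -> lmx mul u = 1%:M.
Proof. by move=> mulP uP; apply: eq_mulrV => x; rewrite (mul_lmx mulP) mulmx1 uP. Qed.

Lemma rmx_unit (K : fieldType) n (mul : 'rV[K]_n -> 'rV[K]_n -> 'rV[K]_n) u :
  alg_law mul -> (forall x, mul x u = x) -> rmx mul u = 1%:M.
Proof. by move=> mulP uP; apply: eq_mulrV => x; rewrite (mul_rmx mulP) mulmx1 uP. Qed.

(** * Tensor products *)

(* [a^T *m b] is the pure tensor of [a] and [b]. *)
Definition tmul (K : fieldType) m n (mulV : 'rV[K]_m -> 'rV[K]_m -> 'rV[K]_m)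
    (mulW : 'rV[K]_n -> 'rV[K]_n -> 'rV[K]_n) (P Q : 'M[K]_(m, n)) : 'M[K]_(m, n) :=
  \sum_i \sum_j P i j *:
    ((lmx mulV (delta_mx 0 i))^T *m Q *m lmx mulW (delta_mx 0 j)).

Lemma delta_pure (K : fieldType) m n (i : 'I_m) (j : 'I_n) :
  delta_mx i j = (delta_mx 0 i : 'rV[K]_m)^T *m (delta_mx 0 j : 'rV[K]_n).
Proof. by rewrite trmx_delta mul_delta_mx. Qed.

Lemma tensor_ext (K : fieldType) m n (U : lmodType K) (f g : 'M[K]_(m, n) -> U) :
    linear f -> linear g ->
    (forall (a : 'rV_m) (b : 'rV_n), f (a^T *m b) = g (a^T *m b)) ->
  f =1 g.
Proof.
move=> lf lg fg P.
pose F : {linear 'M[K]_(m, n) -> U} := HB.pack f (GRing.isLinear.Build _ _ _ _ f lf).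
pose G : {linear 'M[K]_(m, n) -> U} := HB.pack g (GRing.isLinear.Build _ _ _ _ g lg).
change (F P = G P); rewrite [P]matrix_sum_delta !linear_sum.
apply: eq_bigr => i _; rewrite !linear_sum; apply: eq_bigr => j _.
rewrite !linearZ; congr (_ *: _).
rewrite delta_pure; exact: fg.
Qed.

Section Tensor.
Variables (K : fieldType) (m n : nat).
Variables (mulV : 'rV[K]_m -> 'rV[K]_m -> 'rV[K]_m).
Variables (mulW : 'rV[K]_n -> 'rV[K]_n -> 'rV[K]_n).
Hypotheses (mulVP : alg_law mulV) (mulWP : alg_law mulW).
Local Notation "P ** Q" := (tmul mulV mulW P Q) (at level 40, left associativity).

Lemma tmul_linearl Q : linear (fun P => P ** Q).
Proof.
move=> k P P'; rewrite /tmul scaler_sumr -big_split; apply: eq_bigr => i _ /=.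
rewrite scaler_sumr -big_split; apply: eq_bigr => j _ /=.
by rewrite !mxE scalerDl scalerA.
Qed.

Lemma tmul_linearr P : linear (fun Q => P ** Q).
Proof.
move=> k Q Q'; rewrite /tmul scaler_sumr -big_split; apply: eq_bigr => i _ /=.
rewrite scaler_sumr -big_split; apply: eq_bigr => j _ /=.
by rewrite mulmxDr mulmxDl scalerDr -scalemxAr -scalemxAl !scalerA mulrC.
Qed.

Lemma tmul_pure a b Q : (a^T *m b) ** Q = (lmx mulV a)^T *m Q *m lmx mulW b.
Proof.
rewrite (lmx_sum mulVP a) linear_sum !mulmx_suml (lmx_sum mulWP b).
apply: eq_bigr => i _; rewrite linearZ /= !(mulmx_sumr, =^~ scalemxAl).
rewrite scaler_sumr; apply: eq_bigr => j _.
by rewrite -scalemxAr scalerA mxE big_ord1 mxE.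
Qed.

Lemma tmul_pure_r P c d : P ** (c^T *m d) = (rmx mulV c)^T *m P *m rmx mulW d.
Proof.
apply: (tensor_ext (f := fun P => P ** (c^T *m d)) (tmul_linearl _)
  (g := fun P => (rmx mulV c)^T *m P *m rmx mulW d)) => [k Q Q'|a b].
  by rewrite mulmxDr mulmxDl -scalemxAr -scalemxAl.
rewrite tmul_pure !mulmxA -!trmx_mul -!mulmxA.
by rewrite !(mul_lmx mulVP, mul_lmx mulWP, mul_rmx mulVP, mul_rmx mulWP).
Qed.

Lemma tmulA : associative (tmul mulV mulW).
Proof.
move=> P Q X; apply: (tensor_ext (f := fun P => P ** (Q ** X))
   (g := fun P => P ** Q ** X)) P => [|k P P'|a b]; first exact: tmul_linearl.
  by rewrite !tmul_linearl.
apply: (tensor_ext (f := fun Q => a^T *m b ** (Q ** X))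
   (g := fun Q => (a^T *m b) ** Q ** X)) Q => [k Q Q'|k Q Q'|c d].
- by rewrite tmul_linearl tmul_linearr.
- by rewrite tmul_linearr tmul_linearl.
rewrite !tmul_pure !mulmxA -!trmx_mul -!mulmxA.
rewrite (mul_lmx mulVP) (mul_lmx mulWP) tmul_pure (lmx_mul mulVP) (lmx_mul mulWP).
by rewrite !mulmxA trmx_mul.
Qed.

Lemma tmul_law : alg_law (tmul mulV mulW).
Proof.
split=> [|P Q X|P Q X|a P Q|a P Q]; first exact: tmulA.
- by have := tmul_linearl X 1 P Q; rewrite /= !scale1r.
- by have := tmul_linearr P 1 Q X; rewrite /= !scale1r.
- have T0 : 0 ** Q = 0 by have := tmul_linearl Q (-1) 0 0; rewrite /= !scaleN1r !addNr.
  by have := tmul_linearl Q a P 0; rewrite /= !addr0 T0 addr0.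
have T0 : P ** 0 = 0 by have := tmul_linearr P (-1) 0 0; rewrite /= !scaleN1r !addNr.
by have := tmul_linearr P a Q 0; rewrite /= !addr0 T0 addr0.
Qed.

End Tensor.

(** * Central elements in one tensor factor *)

Lemma exists_min (T : Type) (P : T -> Prop) (f : T -> nat) :
  (exists x, P x) -> exists x, P x /\ forall y, P y -> (f x <= f y)%N.
Proof.
case=> x; have [k] := ubnP (f x); elim: k x => // k IH x; rewrite ltnS => fx Px.
have [[y [Py lt_yx]]|nex] := classic (exists y, P y /\ (f y < f x)%N).
  exact: IH (leq_trans lt_yx fx) Py.
exists x; split=> // y Py; rewrite leqNgt; apply/negP => lt_yx.
by apply: nex; exists y.
Qed.

Section CentralColumns.
Variables (K : fieldType) (m n : nat) (mul : 'rV[K]_m -> 'rV[K]_m -> 'rV[K]_m).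
Hypotheses (mulP : alg_law mul) (spV : semiprime mul).

(* Take an element with as few nonzero columns as possible: the elements of [P]
   supported on the same columns are determined by any one of these columns,
   which runs over an ideal and can thus be chosen to be a central idempotent. *)
Lemma central_columns (P : 'M[K]_(m, n) -> Prop) :
    P 0 -> (forall x y, P x -> P y -> P (x + y)) ->
    (forall (k : K) x, P x -> P (k *: x)) ->
    (forall a x, P x -> P ((lmx mul a)^T *m x)) ->
    (forall a x, P x -> P ((rmx mul a)^T *m x)) ->
    (exists2 x, P x & x != 0) ->
  exists y, [/\ P y, y != 0 & forall a, (lmx mul a)^T *m y = (rmx mul a)^T *m y].
Proof.
move=> P0 PD PZ Pl Pr [x0 Px0 nzx0].
pose supp (y : 'M[K]_(m, n)) := [set j | col j y != 0].
have [y [[Py nzy] ymin]] : exists y, (P y /\ y != 0) /\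
    forall y', P y' /\ y' != 0 -> (#|supp y| <= #|supp y'|)%N.
  by apply: exists_min; exists x0.
have [j0 nzj0] : exists j0, col j0 y != 0.
  apply: NNPP => nex; case/eqP: nzy; apply/matrixP => i j.
  have : col j y = 0 by apply/eqP; apply: contraT => nz; case: nex; exists j.
  by move/matrixP/(_ i 0); rewrite !mxE.
pose D z := P z /\ supp z \subset supp y.
have supp_mul (A : 'M[K]_m) (z : 'M[K]_(m, n)) :
    supp z \subset supp y -> supp (A *m z) \subset supp y.
  move/subsetP => sz; apply/subsetP => j; rewrite inE => nz; apply: sz.
  rewrite inE; apply: contraNneq nz => z0.
  by rewrite colE -mulmxA -colE z0 mulmx0.
have DD z z' : D z -> D z' -> D (z + z').
  move=> [Pz /subsetP sz] [Pz' /subsetP sz']; split; first exact: PD.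
  apply/subsetP => j; apply: contraLR => ny.
  have z0 : col j z = 0 by apply/eqP; apply: contraNT ny => nz; apply: sz; rewrite inE.
  have z'0 : col j z' = 0 by apply/eqP; apply: contraNT ny => nz; apply: sz'; rewrite inE.
  by rewrite inE linearD /= z0 z'0 addr0 eqxx.
have DZ k z : D z -> D (k *: z).
  move=> [Pz sz]; split; first exact: PZ.
  by rewrite -mul_scalar_mx; apply: supp_mul.
have Dl a z : D z -> D ((lmx mul a)^T *m z).
  by move=> [Pz sz]; split; [apply: Pl | apply: supp_mul].
have Dr a z : D z -> D ((rmx mul a)^T *m z).
  by move=> [Pz sz]; split; [apply: Pr | apply: supp_mul].
(* A nonzero [z] in [D] with zero column [j0] would have strictly smaller support than [y]. *)
have Dinj z : D z -> col j0 z = 0 -> z = 0.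
  move=> [Pz sz] z0; apply/eqP; apply: contraT => nzz.
  have := ymin z (conj Pz nzz); rewrite leqNgt; case/negP; apply: proper_card.
  rewrite properE sz; apply/subsetPn; exists j0; rewrite !inE //.
  by rewrite z0 eqxx.
have col_mul (A : 'M[K]_m) (z : 'M[K]_(m, n)) : (col j0 (A^T *m z))^T = (col j0 z)^T *m A.
  by rewrite !colE -mulmxA trmx_mul trmxK.
have [I IP] : exists I : {vspace 'rV[K]_m},
    forall v, (exists2 z, D z & v = (col j0 z)^T) <-> v \in I.
  apply: vspace_of_pred.
  - exists 0; last by rewrite col0 trmx0.
    by split=> //; apply/subsetP => j; rewrite inE col0 eqxx.
  - move=> _ _ [z Dz ->] [z' Dz' ->]; exists (z + z'); first exact: DD.
    by rewrite !linearD.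
  - by move=> k _ [z Dz ->]; exists (k *: z); [apply: DZ | rewrite !linearZ].
have [||c [/IP[z Dz cz] cI cC]] := @ideal_unit _ _ _ mulP spV I.
- move=> a _ /IP[z Dz ->]; apply/IP; exists ((lmx mul a)^T *m z); first exact: Dl.
  by rewrite col_mul (mul_lmx mulP).
- move=> a _ /IP[z Dz ->]; apply/IP; exists ((rmx mul a)^T *m z); first exact: Dr.
  by rewrite col_mul (mul_rmx mulP).
exists z; split=> [||a]; first by case: Dz.
  have /cI[cy _] : (col j0 y)^T \in I by apply/IP; exists y.
  apply: contraNneq nzj0 => z0; move: cy; rewrite cz z0 col0 trmx0.
  by rewrite (alg_0mul mulP) => /(congr1 trmx); rewrite trmx0 trmxK => <-.
apply/eqP; rewrite -subr_eq0; apply/eqP; apply: Dinj.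
  by rewrite -scaleN1r; apply: DD; [apply: Dl | apply/DZ/Dr].
apply: trmx_inj; rewrite linearB linearB /= !col_mul -cz (mul_lmx mulP).
by rewrite (mul_rmx mulP) cC subrr trmx0.
Qed.

End CentralColumns.

(** * Reducedness of central tensors *)

(** A polynomial [h(M)] in the multiplication [M] by [z] is multiplication by the central element
    [w = u h(M)], so by semiprimeness it vanishes if its square does. If [q g^2] is the minimal
    polynomial, it divides [(q g)^2]; then [q g] annihilates [M], and [g] is constant. *)
Lemma central_mxminpoly_separable (K : fieldType) m
    (mul : 'rV[K]_m.+1 -> 'rV[K]_m.+1 -> 'rV[K]_m.+1) z :
    perfect_field K -> alg_law mul -> semiprime mul ->
    (forall a, mul a z = mul z a) ->
  separable_poly (mxminpoly (lmx mul z)).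
Proof.
move=> perfK mulP spV cz; apply: perfect_squarefree_separable => // g g1.
have [u uP] := semiprime_unit mulP spV.
set M := lmx mul z; apply/negP => /dvdpP[q Dq].
have Mr a : comm_mx M (rmx mul a) by apply: lmx_rmxC.
have ML a : comm_mx M (lmx mul a).
  by rewrite /comm_mx /M -!(lmx_mul mulP) cz.
have M0 h : horner_mx M h *m horner_mx M h = 0 -> horner_mx M h = 0.
  move=> h0; pose w := u *m horner_mx M h.
  have wx x : mul w x = x *m horner_mx M h.
    rewrite -(mul_rmx mulP) /w -mulmxA (comm_horner_mx _ (Mr x)) mulmxA.
    by rewrite (mul_rmx mulP) (uP x).1.
  have xw x : mul x w = x *m horner_mx M h.
    rewrite -(mul_lmx mulP) /w -mulmxA (comm_horner_mx _ (ML x)) mulmxA.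
    by rewrite (mul_lmx mulP) (uP x).2.
  suff w0 : w = 0.
    by apply: eq_mulrV => x; rewrite -wx w0 (alg_0mul mulP) mulmx0.
  by apply: spV => t; rewrite wx xw -mulmxA h0 mulmx0.
have nzp : mxminpoly M != 0 by rewrite monic_neq0 ?mxminpoly_monic.
have nzqg : q * g != 0.
  by apply: contraNneq nzp => qg; rewrite Dq expr2 mulrA qg mul0r.
have /mxminpoly_min : horner_mx M (q * g) = 0.
  apply: M0; rewrite mulmxE -rmorphM.
  have -> : q * g * (q * g) = q * mxminpoly M by rewrite Dq expr2 !mulrA (mulrAC q g q).
  by rewrite rmorphM /= mx_root_minpoly mulr0.
rewrite Dq expr2 mulrA -[X in _ %| X]mulr1 dvdp_mul2l // dvdp1.
exact/negP.
Qed.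

(** A split separable minimal polynomial gives diagonalizability, and commuting diagonalizable
    matrices share an eigenbasis. The columns of [G] are the common eigenvectors. *)
Lemma codiagonalize (K L : fieldType) (f : {rmorphism K -> L}) m r
    (A : 'I_r -> 'M[K]_m.+1) (rs : seq L) :
    (forall i j, comm_mx (A i) (A j)) ->
    (forall i, separable_poly (mxminpoly (A i))) ->
    (forall i, map_poly f (mxminpoly (A i)) %| \prod_(x <- rs) ('X - x%:P)) ->
  exists2 G, G \in unitmx & exists D : 'I_r -> 'rV[L]_m.+1,
    forall i, map_mx f (A i) *m G = G *m diag_mx (D i).
Proof.
move=> cA sepA splitA; pose As := [seq map_mx f (A i) | i <- enum 'I_r].
have /codiagonalizableP[P Pu /allP PA] :
    {in As &, forall B C, comm_mx B C} /\ (forall B, B \in As -> diagonalizable B).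
  split=> [_ _ /mapP[i _ ->] /mapP[j _ ->]|_ /mapP[i _ ->]].
    by rewrite /comm_mx -!map_mxM cA.
  apply/diagonalizableP; rewrite mxminpoly_map.
  have [s eqs] := dvdp_prod_XsubC (splitA i).
  exists (mask s rs); last by rewrite (eqp_dvdl _ eqs).
  by rewrite -separable_prod_XsubC -(eqp_separable eqs) separable_map.
exists (invmx P); first by rewrite unitmx_inv.
have /fin_all_exists[D DP] : forall i, exists d : 'rV[L]_m.+1,
    map_mx f (A i) = conjmx (invmx P) (diag_mx d).
  move=> i; apply/(diagonalizable_forLR Pu); apply: PA.
  by apply: map_f; rewrite mem_enum.
by exists D => i; rewrite DP conjumx ?unitmx_inv // invmxK mulmxK // mulmxV.
Qed.

(** Over a splitting field of all the minimal polynomials, a change of basis on both sides turns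
    [Q |-> \sum_i (A i)^T Q (B i)] into entrywise multiplication by scalars [s]. The entries of [y]
    become [s o], and [s (s o) = 0] forces [s o = 0]. *)
Lemma separable_family_reduced (K : fieldType) m n r
    (A : 'I_r -> 'M[K]_m.+1) (B : 'I_r -> 'M[K]_n.+1) (o y : 'M[K]_(m.+1, n.+1)) :
    (forall i j, comm_mx (A i) (A j)) -> (forall i j, comm_mx (B i) (B j)) ->
    (forall i, separable_poly (mxminpoly (A i))) ->
    (forall i, separable_poly (mxminpoly (B i))) ->
    y = \sum_i (A i)^T *m o *m B i -> \sum_i (A i)^T *m y *m B i = 0 ->
  y = 0.
Proof.
move=> cA cB sepA sepB yE y0.
pose p := (\prod_i mxminpoly (A i)) * (\prod_i mxminpoly (B i)).
have nzp : p != 0.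
  by rewrite mulf_neq0 // prodf_seq_neq0;
     apply/allP => i _; rewrite /= monic_neq0 ?mxminpoly_monic.
have [L [f [c [rs Dp]]]] := splitting_extension nzp.
have nzc : c != 0.
  apply: contraNneq nzp => c0; rewrite -(map_poly_eq0 f) Dp c0 scale0r eqxx //.
have split q : q %| p -> map_poly f q %| \prod_(x <- rs) ('X - x%:P).
  by rewrite -(dvdp_map f) Dp dvdpZr.
have [i|G Gu [D AG]] := codiagonalize (f := f) (rs := rs) cA sepA.
  by apply: split; rewrite /p (bigD1 i) //= -mulrA dvdp_mulIl.
have [i|H Hu [E BH]] := codiagonalize (f := f) (rs := rs) cB sepB.
  by apply: split; rewrite /p mulrC (bigD1 i) //= -mulrA dvdp_mulIl.
pose N Q := G^T *m map_mx f Q *m H.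
have NE Q i j : N (\sum_k (A k)^T *m Q *m B k) i j
    = (\sum_k D k 0 i * E k 0 j) * N Q i j.
  rewrite /N map_mx_sum mulmx_sumr mulmx_suml summxE mulr_suml.
  apply: eq_bigr => k _; rewrite !map_mxM -map_trmx !mulmxA -trmx_mul AG.
  rewrite trmx_mul tr_diag_mx -!mulmxA BH !mulmxA.
  by rewrite mul_mx_diag mxE -!mulmxA mul_diag_mx mxE mulrAC.
have N0 : N y = 0.
  apply/matrixP => i j; rewrite [RHS]mxE; apply/eqP; rewrite -sqrf_eq0 expr2.
  rewrite {1}yE NE mulrAC -NE y0 /N map_mx0 mulmx0 mul0mx mxE mul0r //.
apply/eqP; rewrite -(map_mx_eq0 f); apply/eqP.
have -> : map_mx f y = invmx G^T *m N y *m invmx H.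
  by rewrite /N -!mulmxA mulmxV // mulmx1 mulKmx ?unitmx_tr.
by rewrite N0 mulmx0 mul0mx.
Qed.

Lemma mulmx_sum_col_row (R : pzSemiRingType) m n p (A : 'M[R]_(m, n)) (B : 'M[R]_(n, p)) :
  A *m B = \sum_k col k A *m row k B.
Proof.
apply/matrixP => i j; rewrite mxE summxE; apply: eq_bigr => k _.
by rewrite mxE big_ord1 !mxE.
Qed.

(** By a rank factorization, [y] is a sum of pure tensors of [z k] and [z' k], and its centrality
    passes to all of these. Left multiplication by [y] then has the form treated in
    [separable_family_reduced], with [o] the unit tensor. *)
Lemma tensor_central_reduced (K : fieldType) m n
    (mulV : 'rV[K]_m -> 'rV[K]_m -> 'rV[K]_m)
    (mulW : 'rV[K]_n -> 'rV[K]_n -> 'rV[K]_n) (y : 'M[K]_(m, n)) :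
    perfect_field K -> alg_law mulV -> alg_law mulW ->
    semiprime mulV -> semiprime mulW ->
    (forall a, (lmx mulV a)^T *m y = (rmx mulV a)^T *m y) ->
    (forall b, y *m lmx mulW b = y *m rmx mulW b) ->
  tmul mulV mulW y y = 0 -> y = 0.
Proof.
case: m mulV y => [|m] mulV y; first by rewrite [y]flatmx0.
case: n mulW y => [|n] mulW y; first by rewrite [y]thinmx0.
move=> perfK mulVP mulWP spV spW yV yW yy.
pose z k := (col k (col_base y))^T; pose z' k := row k (row_base y).
have [u uP] := semiprime_unit mulVP spV; have [v vP] := semiprime_unit mulWP spW.
have yE : y = \sum_k (z k)^T *m z' k.
  rewrite -{1}(mulmx_base y) mulmx_sum_col_row.
  by apply: eq_bigr => k _; rewrite trmxK.
have zC k a : mulV a (z k) = mulV (z k) a.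
  (* The factor [B] acts on the side opposite to the commutation relation [yV], so
     [col_base y = y B] inherits it. *)
  have /row_freeP[B rB] := row_base_free y.
  have cE : col_base y = y *m B by rewrite -[X in _ = X *m B](mulmx_base y) -mulmxA rB mulmx1.
  rewrite -(mul_lmx mulVP) -(mul_rmx mulVP) /z; apply: trmx_inj.
  by rewrite !trmx_mul !trmxK colE cE !mulmxA yV.
have z'C k b : mulW b (z' k) = mulW (z' k) b.
  have /row_fullP[B cB] := col_base_full y.
  have rE : row_base y = B *m y by rewrite -[X in _ = B *m X](mulmx_base y) mulmxA cB mul1mx.
  by rewrite -(mul_lmx mulWP) -(mul_rmx mulWP) /z' rowE rE -!mulmxA yW.
have yQ Q : tmul mulV mulW y Q = \sum_k (lmx mulV (z k))^T *m Q *m lmx mulW (z' k).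
  rewrite {1}yE (alg_mul_suml (tmul_law mulVP mulWP)); apply: eq_bigr => k _.
  exact: tmul_pure.
have yu : tmul mulV mulW y (u^T *m v) = y.
  rewrite (tmul_pure_r mulVP mulWP) (rmx_unit mulVP (fun x => (uP x).2)).
  rewrite (rmx_unit mulWP (fun x => (vP x).2)).
  by rewrite trmx1 mul1mx mulmx1.
apply: (@separable_family_reduced _ _ _ _ (fun k => lmx mulV (z k))
  (fun k => lmx mulW (z' k)) (u^T *m v)).
- by move=> i j; rewrite /comm_mx -!(lmx_mul mulVP) zC.
- by move=> i j; rewrite /comm_mx -!(lmx_mul mulWP) z'C.
- by move=> i; apply: central_mxminpoly_separable => // a; apply: zC.
- by move=> i; apply: central_mxminpoly_separable => // a; apply: z'C.
- by rewrite -yQ yu.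
- by rewrite -yQ.
Qed.

(** * Semiprimeness of tensor products *)

Section TensorSemiprime.
Variables (K : fieldType) (m n : nat).
Variables (mulV : 'rV[K]_m -> 'rV[K]_m -> 'rV[K]_m).
Variables (mulW : 'rV[K]_n -> 'rV[K]_n -> 'rV[K]_n).
Hypotheses (perfK : perfect_field K) (mulVP : alg_law mulV) (mulWP : alg_law mulW).
Hypotheses (spV : semiprime mulV) (spW : semiprime mulW).
Local Notation "P ** Q" := (tmul mulV mulW P Q) (at level 40, left associativity).

(** Were [x] nonzero, [central_columns] applied to each factor in turn would produce, in an ideal
    [I] containing [x], a nonzero tensor central over both factors and of square zero, against
    [tensor_central_reduced]. *)
Lemma tensor_semiprime : semiprime (tmul mulV mulW).
Proof.
move=> x xx; have lawT := tmul_law mulVP mulWP; have mA := alg_mulA lawT.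
have [u uP] := semiprime_unit mulVP spV; have [v vP] := semiprime_unit mulWP spW.
have lu := lmx_unit mulVP (fun a => (uP a).1); have ru := rmx_unit mulVP (fun a => (uP a).2).
have lv := lmx_unit mulWP (fun a => (vP a).1); have rv := rmx_unit mulWP (fun a => (vP a).2).
(* An ideal containing [x] all of whose elements [y] satisfy [y C y = 0]. *)
pose I y := (forall c, x ** c ** y = 0) /\
  (forall c z, (forall d, x ** d ** z = 0) -> y ** c ** z = 0).
have I0 : I 0 by split=> *; rewrite ?(alg_0mul lawT) ?(alg_mul0 lawT).
have ID y z : I y -> I z -> I (y + z).
  move=> [y1 y2] [z1 z2]; split=> [c|c w xw].
    by rewrite (alg_mulDr lawT) y1 z1 addr0.
  by rewrite !(alg_mulDl lawT) y2 ?z2 ?addr0.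
have IZ (k : K) y : I y -> I (k *: y).
  move=> [y1 y2]; split=> [c|c w xw].
    by rewrite (alg_mulZr lawT) y1 scaler0.
  by rewrite !(alg_mulZl lawT) y2 ?scaler0.
have Il a y : I y -> I (a ** y).
  move=> [y1 y2]; split=> [c|c w xw]; first by rewrite mA -(mA x) y1.
  by rewrite -!mA (mA y) y2 ?(alg_mul0 lawT).
have Ir a y : I y -> I (y ** a).
  move=> [y1 y2]; split=> [c|c w xw]; first by rewrite mA y1 (alg_0mul lawT).
  by rewrite -(mA y) y2.
have IVl a y : I y -> I ((lmx mulV a)^T *m y).
  by move=> /(Il (a^T *m v)); rewrite (tmul_pure mulVP mulWP) lv mulmx1.
have IVr a y : I y -> I ((rmx mulV a)^T *m y).
  by move=> /(Ir (a^T *m v)); rewrite (tmul_pure_r mulVP mulWP) rv mulmx1.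
have IWl b y : I y -> I (y *m lmx mulW b).
  by move=> /(Il (u^T *m b)); rewrite (tmul_pure mulVP mulWP) lu trmx1 mul1mx.
have IWr b y : I y -> I (y *m rmx mulW b).
  by move=> /(Ir (u^T *m b)); rewrite (tmul_pure_r mulVP mulWP) ru trmx1 mul1mx.
apply/eqP; apply: contraT => nzx.
have [|y [Iy nzy yC]] := central_columns mulVP spV I0 ID IZ IVl IVr.
  by exists x.
(* Transposition exchanges the factors; the second conjunct preserves centrality over the first
   factor during the second application. *)
pose P (w : 'M[K]_(n, m)) :=
  I w^T /\ forall a, (lmx mulV a)^T *m w^T = (rmx mulV a)^T *m w^T.
have P0 : P 0 by rewrite /P trmx0; split=> // a; rewrite !mulmx0.
have PD w w' : P w -> P w' -> P (w + w').
  move=> [Iw wC] [Iw' w'C]; rewrite /P linearD; split=> [|a]; first exact: ID.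
  by rewrite !mulmxDr wC w'C.
have PZ (k : K) w : P w -> P (k *: w).
  move=> [Iw wC]; rewrite /P linearZ; split=> [|a]; first exact: IZ.
  by rewrite -!scalemxAr wC.
have Pl b w : P w -> P ((lmx mulW b)^T *m w).
  move=> [Iw wC]; rewrite /P trmx_mul trmxK; split=> [|a]; first exact: IWl.
  by rewrite !mulmxA wC.
have Pr b w : P w -> P ((rmx mulW b)^T *m w).
  move=> [Iw wC]; rewrite /P trmx_mul trmxK; split=> [|a]; first exact: IWr.
  by rewrite !mulmxA wC.
have [|w [[[w1 w2] wC] nzw wC']] := central_columns mulWP spW P0 PD PZ Pl Pr.
  by exists y^T; rewrite /P ?trmxK // trmx_eq0.
case/eqP: nzw; apply: trmx_inj; rewrite trmx0.
apply: (tensor_central_reduced perfK mulVP mulWP) => // [b|].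
  by apply: trmx_inj; rewrite !trmx_mul trmxK wC'.
have := w2 (u^T *m v) _ w1.
by rewrite (tmul_pure_r mulVP mulWP) ru rv trmx1 mul1mx mulmx1.
Qed.

End TensorSemiprime.

(** * Separability idempotents *)

Section Separability.
Variables (K : fieldType) (n : nat) (mul : 'rV[K]_n -> 'rV[K]_n -> 'rV[K]_n).
Hypotheses (perfK : perfect_field K) (mulP : alg_law mul) (spV : semiprime mul).

(** The multiplication map from the tensor square to the algebra, in coordinates. *)
Definition contract (P : 'M[K]_n) : 'rV[K]_n :=
  \sum_i \sum_j P i j *: mul (delta_mx 0 i) (delta_mx 0 j).

Lemma contract_linear : linear contract.
Proof.
move=> k P Q; rewrite /contract scaler_sumr -big_split; apply: eq_bigr => i _ /=.
rewrite scaler_sumr -big_split; apply: eq_bigr => j _ /=.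
by rewrite !mxE scalerDl scalerA.
Qed.

Lemma contract_pure a b : contract (a^T *m b) = mul a b.
Proof.
rewrite {2}[a]row_sum_delta (alg_mul_suml mulP); apply: eq_bigr => i _.
rewrite (alg_mulZl mulP) {2}[b]row_sum_delta (alg_mul_sumr mulP) scaler_sumr.
by apply: eq_bigr => j _; rewrite (alg_mulZr mulP) scalerA mxE big_ord1 mxE.
Qed.

(* The complement of a right unit of the left ideal [contract P = 0] of the
   enveloping algebra. *)
Lemma separability_idempotent :
  exists P, (forall a, (lmx mul a)^T *m P = P *m rmx mul a) /\
            (forall x, mul (contract P) x = x).
Proof.
have mulPo := alg_law_op mulP.
have lawT := tmul_law mulP mulPo.
have spT := tensor_semiprime perfK mulP mulPo spV (semiprime_op mulP spV).
have [u uP] := semiprime_unit mulP spV.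
have lu := lmx_unit mulP (fun a => (uP a).1); have ru := rmx_unit mulP (fun a => (uP a).2).
set tm := tmul _ _ in lawT spT.
have c0 : contract 0 = 0.
  by have := contract_linear (-1) 0 0; rewrite /= !scaleN1r !addNr.
have cD P Q : contract (P + Q) = contract P + contract Q.
  by have := contract_linear 1 P Q; rewrite /= !scale1r.
have cZ (k : K) P : contract (k *: P) = k *: contract P.
  by have := contract_linear k P 0; rewrite /= c0 !addr0.
have [L LP] : exists L : {vspace 'M[K]_n}, forall P, contract P = 0 <-> P \in L.
  apply: vspace_of_pred => // [P Q P0 Q0|k P P0]; first by rewrite cD P0 Q0 addr0.
  by rewrite cZ P0 scaler0.
(* [contract] is a map of modules over the enveloping algebra, whose product is [tm], so its kernel
   [L] is a left ideal. *)
have ctm a b P : contract (tm (a^T *m b) P) = mul (mul a (contract P)) b.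
  have -> : tm (a^T *m b) P = (lmx mul a)^T *m P *m rmx mul b.
    exact: (tmul_pure mulP mulPo a b P).
  apply: (tensor_ext (f := fun P => contract ((lmx mul a)^T *m P *m rmx mul b))
    (g := fun P => mul (mul a (contract P)) b)) => [k Q Q'|k Q Q'|c d].
  - by rewrite mulmxDr mulmxDl -scalemxAr -scalemxAl contract_linear.
  - rewrite contract_linear (alg_mulDr mulP) (alg_mulDl mulP).
    by rewrite (alg_mulZr mulP) (alg_mulZl mulP).
  rewrite !mulmxA -trmx_mul -mulmxA (mul_lmx mulP) (mul_rmx mulP).
  by rewrite !contract_pure !(alg_mulA mulP).
have idL : left_ideal tm L.
  move=> X P /LP P0; apply/LP.
  apply: (tensor_ext (f := fun X => contract (tm X P)) (g := fun=> 0)) => [k Q Q'|k Q Q'|a b].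
  - by rewrite (alg_mulDl lawT) (alg_mulZl lawT) contract_linear.
  - by rewrite scaler0 addr0.
  by rewrite ctm P0 (alg_mul0 mulP) (alg_0mul mulP).
have [e /LP e0 eP] := left_ideal_unit lawT spT idL.
(* [o] is the unit tensor. Every [X] in [L] satisfies [X (o - e) = 0]; the claimed commutation is
   the case where [X] is [a^T *m u - u^T *m a]. *)
pose o := u^T *m u; exists (o - e); split=> [a|x]; last first.
  by rewrite -scaleN1r cD cZ e0 scaler0 addr0 contract_pure !(uP _).1.
have la Q : tm (a^T *m u) Q = (lmx mul a)^T *m Q.
  have -> : tm (a^T *m u) Q = (lmx mul a)^T *m Q *m rmx mul u.
    exact: (tmul_pure mulP mulPo a u Q).
  by rewrite ru mulmx1.
have ra Q : tm (u^T *m a) Q = Q *m rmx mul a.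
  have -> : tm (u^T *m a) Q = (lmx mul u)^T *m Q *m rmx mul a.
    exact: (tmul_pure mulP mulPo u a Q).
  by rewrite lu trmx1 mul1mx.
apply/eqP; rewrite -subr_eq0 -la -ra -(alg_Bmul lawT) (alg_mulB lawT) eP; last first.
  apply/LP; rewrite -scaleN1r cD cZ !contract_pure (uP a).1 (uP a).2.
  by rewrite scaleN1r subrr.
rewrite subr_eq0; have to Q : tm Q o = Q.
  have -> : tm Q o = (rmx mul u)^T *m Q *m lmx mul u.
    exact: (tmul_pure_r mulP mulPo Q u u).
  by rewrite lu ru trmx1 mul1mx mulmx1.
by rewrite to.
Qed.

End Separability.

(** * Finite-dimensional semisimple subalgebras *)

Definition comb (K : fieldType) (V : lmodType K) n (b : 'I_n -> V) (v : 'rV[K]_n) : V :=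
  \sum_i v 0 i *: b i.

Section Comb.
Variables (K : fieldType) (V : lmodType K) (n : nat) (b : 'I_n -> V).

Lemma combD v w : comb b (v + w) = comb b v + comb b w.
Proof.
by rewrite /comb -big_split; apply: eq_bigr => i _; rewrite mxE scalerDl.
Qed.

Lemma combZ k v : comb b (k *: v) = k *: comb b v.
Proof. by rewrite /comb scaler_sumr; apply: eq_bigr => i _; rewrite mxE scalerA. Qed.

Lemma comb0 : comb b 0 = 0.
Proof. by have := combZ 0 0; rewrite !scale0r. Qed.

Lemma combB v w : comb b (v - w) = comb b v - comb b w.
Proof. by rewrite -[- w]scaleN1r combD combZ scaleN1r. Qed.

Lemma comb_sum I (r : seq I) (F : I -> 'rV[K]_n) :
  comb b (\sum_(i <- r) F i) = \sum_(i <- r) comb b (F i).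
Proof. exact: (big_morph _ combD comb0). Qed.

Lemma comb_delta i : comb b (delta_mx 0 i) = b i.
Proof.
rewrite /comb (bigD1 i) //= mxE !eqxx scale1r big1 ?addr0 // => j ne.
by rewrite mxE eqxx (negPf ne) scale0r.
Qed.
End Comb.

Section Subspaces.
Variables (K : fieldType) (R : nalgType K).
Implicit Types (S P : R -> Prop) (s : seq R).

Lemma subspaceB S x y : is_subspace S -> S x -> S y -> S (x - y).
Proof. by case=> _ SD SZ Sx Sy; rewrite -scaleN1r; apply/SD/SZ. Qed.

Lemma subspace_sum S I (r : seq I) (F : I -> R) :
  is_subspace S -> (forall i, S (F i)) -> S (\sum_(i <- r) F i).
Proof. by case=> S0 SD _ SF; apply: big_ind => // i _; apply: SF. Qed.

Lemma subspace_comb S n (b : 'I_n -> R) v :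
  is_subspace S -> (forall i, S (b i)) -> S (comb b v).
Proof.
by move=> subS Sb; apply: subspace_sum => // i; case: subS => _ _; apply.
Qed.

Lemma in_span_subspace s : is_subspace (in_span s).
Proof.
split=> [|_ _ [c ->] [d ->]|k _ [c ->]].
- by exists (fun=> 0); rewrite big1 // => i _; rewrite scale0r.
- exists (fun i => c i + d i); rewrite -big_split; apply: eq_bigr => i _.
  by rewrite scalerDl.
- exists (fun i => k * c i); rewrite scaler_sumr; apply: eq_bigr => i _.
  by rewrite scalerA.
Qed.

Lemma in_span_mem s x : x \in s -> in_span s x.
Proof.
rewrite -index_mem => lt_xs; pose j := Ordinal lt_xs.
exists (fun i => (i == j)%:R); rewrite (bigD1 j) //= eqxx scale1r nth_index.
  by rewrite big1 ?addr0 // => i /negPf->; rewrite scale0r.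
by rewrite -index_mem.
Qed.

Lemma in_span_min s P x :
  is_subspace P -> (forall y, y \in s -> P y) -> in_span s x -> P x.
Proof.
move=> subP sP [c ->]; apply: subspace_sum => // i.
by case: subP => _ _; apply; apply/sP/mem_nth.
Qed.

Lemma nalg_law : alg_law (nmul R).
Proof. split; [exact: nmulA | exact: nmulDl | exact: nmulDr | exact: nmulZl | exact: nmulZr]. Qed.

Lemma nmul_nprod (p a : R) s : nmul R p (nprod a s) = nprod (nmul R p a) s.
Proof. by elim: s p a => //= b s IH p a; rewrite /nprod /= -!/(nprod _ _) IH nmulA. Qed.

Lemma nprod0 s : nprod (0 : R) s = 0.
Proof. by elim: s => //= b s IH; rewrite /nprod /= (alg_0mul nalg_law). Qed.

(** The [y] in [S] such that [x S y = 0], and [y S z = 0] whenever [z] in [S] has [x S z = 0], form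
    an ideal whose triple products vanish. It contains [x] as soon as [x S x = 0]. *)
Lemma semisimple_semiprime S : is_subalg S -> semisimple_sub S ->
  forall x, S x -> (forall t, S t -> nmul R (nmul R x t) x = 0) -> x = 0.
Proof.
move=> [[S0 SD SZ] SM] ssS x Sx xx; have law := nalg_law.
pose P z := S z /\ forall d, S d -> nmul R (nmul R x d) z = 0.
pose I y := P y /\ forall c z, S c -> P z -> nmul R (nmul R y c) z = 0.
apply: (ssS I); last by split=> // c z Sc [_]; apply.
  split; last first.
  - move=> a y Sa [[Sy y1] y2]; split; last first.
      by move=> c z Sc Pz; rewrite -(nmulA y) y2 //; apply: SM.
    by split=> [|d Sd]; [apply: SM | rewrite nmulA y1 // (alg_0mul law)].
  - move=> a y Sa [[Sy y1] y2]; split; last first.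
      by move=> c z Sc Pz; rewrite -!nmulA (nmulA y) y2 // (alg_mul0 law).
    by split=> [|d Sd]; [apply: SM | rewrite nmulA -(nmulA x) y1 //; apply: SM].
  - by move=> y [[]].
  split=> [|y z [[Sy y1] y2] [[Sz z1] z2]|k y [[Sy y1] y2]].
  - split=> [|c z Sc Pz]; last by rewrite !(alg_0mul law).
    by split=> // d Sd; rewrite (alg_mul0 law).
  - split=> [|c w Sc Pw]; last by rewrite !nmulDl y2 // z2 // addr0.
    by split=> [|d Sd]; [apply: SD | rewrite nmulDr y1 // z1 // addr0].
  - split=> [|c w Sc Pw]; last by rewrite !nmulZl y2 // scaler0.
    by split=> [|d Sd]; [apply: SZ | rewrite nmulZr y1 // scaler0].
(* [nprod] has one factor more than the length of its list, so [2] stands for products of three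
   elements. *)
exists 2%N => y [|z [|w []]] // _ Iy Is.
have [[Sz _] _] := Is z (mem_head _ _).
have [Pw _] : I w by apply: Is; rewrite !inE eqxx orbT.
by case: Iy => _; apply.
Qed.

(** Induction on the nilpotency exponent. If products of [k.+2] factors from [I] vanish and [p] has
    [k.+1] factors, the first being [x], then [p t p] begins with [p (t x)], a product of [k.+2]
    factors. Hence [p t p = 0] for all [t], and [p = 0]. *)
Lemma semiprime_semisimple S : is_subalg S ->
  (forall x, S x -> (forall t, S t -> nmul R (nmul R x t) x = 0) -> x = 0) ->
  semisimple_sub S.
Proof.
move=> [_ SM] spS I [_ IS Il Ir] [k nilI].
elim: k nilI => [|k IH] nilI x Ix; first by rewrite -[x]/(nprod x [::]) nilI.
apply: (IH _ x Ix) => {Ix}x s sz Ix Is.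
have In (y : R) s' : I y -> (forall z, z \in s' -> I z) -> I (nprod y s').
  elim: s' y => //= a s' IHs y Iy Is'; apply: IHs.
    by apply: Il; [apply: IS | apply: Is'; rewrite mem_head].
  by move=> z zs; apply: Is'; rewrite inE zs orbT.
have Ip := In x s Ix Is; apply: spS => [|t St]; first exact: IS.
rewrite nmul_nprod -nmulA.
have -> : nmul R (nprod x s) (nmul R t x) = nprod x (rcons s (nmul R t x)).
  by rewrite /nprod -cats1 foldl_cat.
rewrite (nilI x (rcons _ _)) ?nprod0 ?size_rcons ?sz // => z; rewrite mem_rcons inE.
by case/orP=> [/eqP->|/Is //]; apply: Il => //; apply: IS.
Qed.

(** A spanning family of least length is a basis: a relation with [v 0 i] nonzero would allow [b i]
    to be dropped. Transporting the product to ['rV[K]_n] gives access to subspace dimensions. *)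
Lemma fdss_coordinates S : fdss_subalg S ->
  exists n (b : 'I_n -> R) (mul : 'rV[K]_n -> 'rV[K]_n -> 'rV[K]_n),
    [/\ alg_law mul, semiprime mul, forall x, S x <-> exists v, x = comb b v,
        forall v, comb b v = 0 -> v = 0 &
        forall v w, comb b (mul v w) = nmul R (comb b v) (comb b w)].
Proof.
move=> [algS [s sP] ssS]; have law := nalg_law.
have spS := semisimple_semiprime algS ssS; case: algS => subS SM.
pose spans n := exists b : 'I_n -> R, forall x, S x <-> exists v, x = comb b v.
have [n [[b bP] nmin]] : exists n, spans n /\ forall n', spans n' -> (n <= n')%N.
  apply: (exists_min id); exists (size s), (fun i => s`_i) => x.
  rewrite sP; split=> [[c ->]|[v ->]]; last by exists (fun i => v 0 i).
  by exists (\row_i c i); apply: eq_bigr => i _; rewrite mxE.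
have Sb i : S (b i) by apply/bP; exists (delta_mx 0 i); rewrite comb_delta.
have b_free v : comb b v = 0 -> v = 0.
  move=> v0; apply: NNPP => nzv.
  have [i nzi] : exists i, v 0 i != 0.
    apply: NNPP => nex; apply: nzv; apply/rowP => i; rewrite mxE.
    by apply/eqP; apply: contraT => nz; case: nex; exists i.
  suff /nmin : spans n.-1 by rewrite leqNgt ltn_predL (leq_ltn_trans (leq0n _) (ltn_ord i)).
  exists (fun k => b (lift i k)) => x; split=> [/bP[w ->]|[w ->]]; last first.
    by apply: subspace_comb => // k; apply: Sb.
  pose w' := w - (w 0 i / v 0 i) *: v.
  exists (\row_k w' 0 (lift i k)).
  have -> : comb b w = comb b w' by rewrite combB combZ v0 scaler0 subr0.
  rewrite {1}/comb (bigD1_ord i) //= !mxE divfK // subrr scale0r add0r.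
  by apply: eq_bigr => k _; rewrite mxE.
have inj v w : comb b v = comb b w -> v = w.
  by move=> vw; apply/eqP; rewrite -subr_eq0; apply/eqP/b_free; rewrite combB vw subrr.
have /fin_all_exists[c cP] (ij : 'I_n * 'I_n) :
    exists v, nmul R (b ij.1) (b ij.2) = comb b v by apply/bP/SM.
pose mul (v w : 'rV[K]_n) := \sum_i \sum_j (v 0 i * w 0 j) *: c (i, j).
have mulE v w : comb b (mul v w) = nmul R (comb b v) (comb b w).
  rewrite comb_sum (alg_mul_suml law); apply: eq_bigr => i _.
  rewrite comb_sum (alg_mul_sumr law); apply: eq_bigr => j _.
  by rewrite combZ -cP nmulZl nmulZr scalerA.
exists n, b, mul; split=> //.
  split=> [x y z|x y z|x y z|k x y|k x y]; apply: inj; rewrite ?(mulE, combD, combZ).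
  - exact: nmulA.
  - exact: nmulDl.
  - exact: nmulDr.
  - exact: nmulZl.
  - exact: nmulZr.
move=> v vv; apply: b_free; apply: spS; first by apply/bP; exists v.
by move=> _ /bP[w ->]; rewrite -!mulE vv comb0.
Qed.

Lemma fdss_unit S : fdss_subalg S ->
  exists2 e, S e & forall x, S x -> nmul R e x = x /\ nmul R x e = x.
Proof.
move=> /fdss_coordinates[n [b [mul [mulP spV bP _ mulE]]]].
have [u uP] := semiprime_unit mulP spV; exists (comb b u); first by apply/bP; exists u.
by move=> _ /bP[v ->]; rewrite -!mulE (uP v).1 (uP v).2.
Qed.

End Subspaces.

(** * Local units commuting with a finite-dimensional quotient *)

Section CommutingUnits.
Variables (K : fieldType) (R : nalgType K).
Local Notation "x ** y" := (nmul R x y) (at level 40, left associativity).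
Let law := nalg_law R.

(* Fitting: the images [q^k D] stabilize, so that [q^m = q^(2m) w], and
   [q^m w] is the idempotent. *)
Lemma fitting_idempotent (S : R -> Prop) q : fdss_subalg S -> S q ->
  exists e, [/\ S e, e ** e = e, forall r, r ** q = q ** r -> r ** e = e ** r,
    forall x, q ** x = x -> e ** x = x & forall x, x ** q = x -> x ** e = x].
Proof.
move=> fdS Sq; have [[[S0 SD SZ] SM] _ _] := fdS.
have [n [b [_ [_ _ bP b_free _]]]] := fdss_coordinates fdS.
pose D y := S y /\ forall r, r ** q = q ** r -> r ** y = y ** r.
have DM y z : D y -> D z -> D (y ** z).
  move=> [Sy yC] [Sz zC]; split=> [|r rq]; first exact: SM.
  by rewrite nmulA yC // -!nmulA zC.
have Dq : D q by [].
pose pw k y := iter k (nmul R q) y.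
have pwD k y z : pw k (y + z) = pw k y + pw k z.
  by elim: k => //= k ->; rewrite nmulDr.
have pwZ k c y : pw k (c *: y) = c *: pw k y.
  by elim: k => //= k ->; rewrite nmulZr.
have Dpw k y : D y -> D (pw k y) by move=> Dy; elim: k => //= k; apply: DM.
have pwS k y : pw k.+1 y = pw k q ** y.
  by elim: k => // k IH; rewrite -[LHS]/(q ** pw k.+1 y) IH nmulA.
have imP k : exists U : {vspace 'rV[K]_n},
    forall v, (exists2 y, D y & comb b v = pw k y) <-> v \in U.
  apply: vspace_of_pred.
  - exists 0; last by rewrite comb0; elim: k => //= k <-; rewrite (alg_mul0 law).
    by split=> // r _; rewrite (alg_mul0 law) (alg_0mul law).
  - move=> v w [y [Sy yC] vy] [z [Sz zC] wz]; exists (y + z).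
      by split=> [|r rq]; [apply: SD | rewrite nmulDr nmulDl yC ?zC].
    by rewrite combD vy wz pwD.
  - move=> c v [y [Sy yC] vy]; exists (c *: y).
      by split=> [|r rq]; [apply: SZ | rewrite nmulZr nmulZl yC].
    by rewrite combZ vy pwZ.
pose im (kU : nat * {vspace 'rV[K]_n}) :=
  forall v, (exists2 y, D y & comb b v = pw kU.1 y) <-> v \in kU.2.
have [[k U] [/= UP Umin]] : exists kU, im kU /\
    forall kU', im kU' -> (\dim kU.2 <= \dim kU'.2)%N.
  by apply: (exists_min (fun kU => \dim kU.2)); have [U UP] := imP 0%N; exists (0%N, U).
(* The doubled exponent uses [k.+1] because [pw k q] is [q^(k+1)]. The new image lies in [U], and
   equals it by minimality. *)
have [U' U'P] := imP (k.+1 + k.+1)%N.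
have eqU : U' = U.
  apply/eqP; rewrite eqEdim (Umin ((k.+1 + k.+1)%N, U')) // andbT; apply/subvP => v /U'P[y Dy vy].
  apply/UP; exists (pw k.+2 y); first exact: Dpw.
  by rewrite vy addSnnS /pw iterD.
have /bP[v pv] : S (pw k q) by case: (Dpw k q Dq).
have /U'P[w [Sw wC]] : v \in U' by rewrite eqU; apply/UP; exists q.
rewrite -pv /pw iterD -!/(pw _ _) !pwS nmulA.
have [_ pC] := Dpw k q Dq; move: pC; set p := pw k q => pC pw2.
have px x : q ** x = x -> p ** x = x.
  move=> qx; rewrite /p -pwS; elim: (k) => [|j] /=; first by rewrite qx.
  by move=> IH; rewrite IH.
have xp x : x ** q = x -> x ** p = x.
  move=> xq; rewrite /p; elim: (k) => //= j IH.
  by rewrite nmulA xq.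
have wq : q ** w = w ** q by apply: wC.
have wp : p ** w = w ** p by apply/esym/pC/esym.
have Sp : S p by case: (Dpw k q Dq).
exists (p ** w); split.
- exact: SM.
- by rewrite {3}pw2 !nmulA -(nmulA p w p) -wp !nmulA.
- by move=> r rq; rewrite nmulA pC // -!nmulA wC.
- move=> x qx; have wx : w ** x = x.
    by rewrite -{2}(px x qx) pw2 -(nmulA p p) wp (nmulA p w) wp -!nmulA !px.
  by rewrite -nmulA wx px.
- move=> x xq; have xw : x ** w = x.
    by rewrite -{2}(xp x xq) pw2 !nmulA !xp.
  by rewrite nmulA xp.
Qed.

Section LocalUnit.
Variables (n : nat) (r : 'I_n -> R) (mul : 'rV[K]_n -> 'rV[K]_n -> 'rV[K]_n).
Variables (J N : R -> Prop) (e : R).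
Hypotheses (perfK : perfect_field K) (mulP : alg_law mul) (spV : semiprime mul).
Hypotheses (idJ : is_ideal J) (Je : J e).
Hypotheses (subN : is_subspace N) (NJ : forall x, N x -> J x).
Hypotheses (Nl : forall i x, N x -> N (r i ** x)) (Nr : forall i x, N x -> N (x ** r i)).
Hypothesis eN : forall x, N x -> e ** x = x /\ x ** e = x.
Hypothesis Nmul : forall i j,
  N (r i ** r j - comb r (mul (delta_mx 0 i) (delta_mx 0 j))).

(** Transports a tensor along [r] and evaluates [B] on it: [B y z = y e z] averages [e] with [P],
    and [B = nmul R] lifts [contract] modulo [N]. *)
Definition bilin (B : R -> R -> R) (P : 'M[K]_n) : R :=
  \sum_i \sum_j P i j *: B (r i) (r j).

Lemma bilin_linear B : linear (bilin B).
Proof.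
move=> k P Q; rewrite /bilin scaler_sumr -big_split; apply: eq_bigr => i _ /=.
rewrite scaler_sumr -big_split; apply: eq_bigr => j _ /=.
by rewrite !mxE scalerDl scalerA.
Qed.

Lemma bilin_mid x v w :
  bilin (fun y z => y ** x ** z) (v^T *m w) = comb r v ** x ** comb r w.
Proof.
rewrite !(alg_mul_suml law); apply: eq_bigr => i _.
rewrite (alg_mul_sumr law); apply: eq_bigr => j _.
by rewrite !nmulZl nmulZr scalerA mxE big_ord1 mxE.
Qed.

Lemma bilin_nmul v w : bilin (nmul R) (v^T *m w) = comb r v ** comb r w.
Proof.
rewrite (alg_mul_suml law); apply: eq_bigr => i _.
rewrite (alg_mul_sumr law); apply: eq_bigr => j _.
by rewrite nmulZl nmulZr scalerA mxE big_ord1 mxE.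
Qed.

Lemma bilin_contract P : N (bilin (nmul R) P - comb r (contract mul P)).
Proof.
rewrite comb_sum -sumrB; apply: subspace_sum => // i.
rewrite comb_sum -sumrB; apply: subspace_sum => // j.
by rewrite combZ -scalerBr; case: subN => _ _; apply.
Qed.

Lemma comb_mul v w : N (comb r v ** comb r w - comb r (mul v w)).
Proof.
by rewrite -bilin_nmul -(contract_pure mulP); apply: bilin_contract.
Qed.

Lemma comb_Nl v x : N x -> N (comb r v ** x).
Proof.
move=> Nx; rewrite (alg_mul_suml law); apply: subspace_sum => // i.
by rewrite nmulZl; case: subN => _ _; apply; apply: Nl.
Qed.

Lemma comb_Nr v x : N x -> N (x ** comb r v).
Proof.
move=> Nx; rewrite (alg_mul_sumr law); apply: subspace_sum => // i.
by rewrite nmulZr; case: subN => _ _; apply; apply: Nr.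
Qed.

Lemma tensor_ind (f : 'M[K]_n -> R) : linear f ->
  (forall v w : 'rV_n, N (f (v^T *m w))) -> forall P, N (f P).
Proof.
move=> lf Nf P.
pose F : {linear 'M[K]_n -> R} := HB.pack f (GRing.isLinear.Build _ _ _ _ f lf).
change (N (F P)); rewrite [P]matrix_sum_delta linear_sum.
apply: subspace_sum => // i; rewrite linear_sum; apply: subspace_sum => // j.
rewrite linearZ; case: subN => _ _; apply.
rewrite delta_pure; exact: Nf.
Qed.

(** On a pure tensor of [v] and [w] the difference is [(a v - mul a v) e w], up to lifting by
    [comb r], with the first factor in [N]. There [e] is a right unit and drops out, and [N] is
    stable under the lifts. *)
Lemma bilin_lmx a P : N (comb r a ** bilin (fun y z => y ** e ** z) P
                         - bilin (fun y z => y ** e ** z) ((lmx mul a)^T *m P)).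
Proof.
move: P; apply: tensor_ind => [k P Q|v w].
  rewrite mulmxDr -scalemxAr !bilin_linear nmulDr nmulZr scalerBr opprD.
  by rewrite addrACA.
rewrite mulmxA -trmx_mul (mul_lmx mulP) !bilin_mid !nmulA -!(alg_Bmul law).
have Nab := comb_mul a v; rewrite (eN Nab).2; exact: comb_Nr.
Qed.

Lemma bilin_rmx a P : N (bilin (fun y z => y ** e ** z) P ** comb r a
                         - bilin (fun y z => y ** e ** z) (P *m rmx mul a)).
Proof.
move: P; apply: tensor_ind => [k P Q|v w].
  rewrite mulmxDl -scalemxAl !bilin_linear nmulDl nmulZl scalerBr opprD.
  by rewrite addrACA.
rewrite -mulmxA (mul_rmx mulP) !bilin_mid -!nmulA -!(alg_mulB law).
have Nab := comb_mul w a; rewrite (eN Nab).1; exact: comb_Nl.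
Qed.

Lemma commuting_local_unit : exists q,
  [/\ J q, forall x, N x -> q ** x = x /\ x ** q = x & forall i, r i ** q = q ** r i].
Proof.
have [[J0 JD JZ] _ Jl Jr] := idJ.
have JB x y : J x -> J y -> J (x - y) by apply: subspaceB.
have [N0 ND NZ] := subN.
have [u uP] := semiprime_unit mulP spV.
have [P [PC Pu]] := separability_idempotent perfK mulP spV.
have {}Pu : contract mul P = u by rewrite -(Pu u) (uP _).2.
pose U := comb r u.
pose G := bilin (fun y z => y ** e ** z) P.
pose M := bilin (nmul R) P.
(* The lift [U] of the unit need not act as the identity on [N], and [G] acts there as [M]. Formally
   [E = (1 - U) e (1 - U)] acts on [N] as [(1 - U)^2], so [G + E] acts as [1 + m]; subtracting [m],
   which lies in [N], leaves the identity. *)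
pose F := e - e ** U; pose E := F - U ** F.
pose m := M - U - (U - U ** U).
have UU : N (U ** U - U) by have := comb_mul u u; rewrite (uP u).1.
have Nm : N m.
  apply: (subspaceB subN); first by rewrite /M /U -Pu; apply: bilin_contract.
  by rewrite -opprB -scaleN1r; apply: NZ.
have JG : J G.
  apply: subspace_sum => [|i]; first by split.
  apply: subspace_sum => [|j]; first by split.
  by apply/JZ/Jr => //; apply: Jl.
have JF : J F by apply: JB => //; apply: Jr.
have JE : J E by apply: JB => //; apply: Jl.
pose g := G + E - m.
have Jg : J g by apply: JB; [apply: JD | apply: NJ].
have sumE (Z n0 Y X : R) : Z + (n0 - Y - X) - (Z - Y - X) = n0.
  by rewrite addrA addrCA -addrA addrK.
have gN x : N x -> g ** x = x.
  move=> Nx; have GM : G ** x = M ** x.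
    rewrite !(alg_mul_suml law); apply: eq_bigr => i _.
    rewrite !(alg_mul_suml law); apply: eq_bigr => j _.
    by rewrite !nmulZl -!nmulA (eN (Nl j Nx)).1.
  have Fx : F ** x = x - U ** x.
    by rewrite (alg_Bmul law) -nmulA (eN Nx).1 (eN (comb_Nl u Nx)).1.
  rewrite (alg_Bmul law) nmulDl GM (alg_Bmul law) -nmulA Fx (alg_mulB law).
  by rewrite !(alg_Bmul law) -(nmulA U U) sumE.
have Ng x : N x -> x ** g = x.
  move=> Nx; have GM : x ** G = x ** M.
    rewrite !(alg_mul_sumr law); apply: eq_bigr => i _.
    rewrite !(alg_mul_sumr law); apply: eq_bigr => j _.
    by rewrite !nmulZr !nmulA (eN (Nr i Nx)).2.
  have xF y : N y -> y ** F = y - y ** U.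
    by move=> Ny; rewrite (alg_mulB law) nmulA (eN Ny).2.
  rewrite (alg_mulB law) nmulDr GM (alg_mulB law x F) nmulA !xF //; last exact: comb_Nr.
  by rewrite !(alg_mulB law) !nmulA sumE.
have EH : E = (e - U ** e) - (e - U ** e) ** U.
  by rewrite /E /F (alg_mulB law) (alg_Bmul law) !opprD !opprK addrACA nmulA.
have comm_g a : N (comb r a ** g - g ** comb r a).
  pose cm x := comb r a ** x - x ** comb r a.
  have cmD x y : cm (x + y) = cm x + cm y by rewrite /cm nmulDr nmulDl opprD addrACA.
  have cmN x : cm (- x) = - cm x by rewrite /cm (alg_mulN law) (alg_Nmul law) opprB opprK addrC.
  rewrite -/(cm g) /g cmD cmN cmD; apply: (subspaceB subN); last first.
    by apply: (subspaceB subN); [apply: comb_Nl | apply: comb_Nr].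
  apply: ND.
    have := subspaceB subN (bilin_lmx a P) (bilin_rmx a P).
    by rewrite PC opprB addrA subrK.
  (* Since [u] is a unit modulo [N], the product of [comb r a] and [1 - U] in either order lies in
     [N]; so each of the two products with [E] is in [N] by itself. *)
  apply: (subspaceB subN).
    have Nnu : N (comb r a - comb r a ** U).
      by rewrite -opprB -scaleN1r; apply: NZ; have := comb_mul a u; rewrite (uP a).2.
    rewrite /E (alg_mulB law) nmulA -(alg_Bmul law) (alg_mulB law) nmulA (eN Nnu).2.
    by apply: (subspaceB subN) => //; apply: comb_Nr.
  have Nnu : N (comb r a - U ** comb r a).
    by rewrite -opprB -scaleN1r; apply: NZ; have := comb_mul u a; rewrite (uP a).1.
  rewrite EH (alg_Bmul law) -nmulA -(alg_mulB law) (alg_Bmul law) -nmulA (eN Nnu).1.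
  by apply: (subspaceB subN) => //; apply: comb_Nl.
(* If [r i g = g (r i) + d] with [d] in [N], then [g d = d g = d], so moving [r i] across [g + g]
   and across [g ** g] leaves the same error [d + d], which cancels. *)
clearbody g; exists (g + g - g ** g); split=> [|x Nx|i].
- by apply: JB; [apply: JD | apply: Jl].
- rewrite (alg_Bmul law) nmulDl -(nmulA g) !(gN x Nx) addrK; split=> //.
  by rewrite (alg_mulB law) nmulDr nmulA !(Ng x Nx) addrK.
have := comm_g (delta_mx 0 i); rewrite comb_delta; set d := _ - _ => Nd.
have rg : r i ** g = g ** r i + d by rewrite /d addrC subrK.
rewrite (alg_mulB law) (alg_Bmul law) nmulDr nmulDl nmulA rg nmulDl.
rewrite -(nmulA g (r i)) rg nmulDr (gN d Nd) (Ng d Nd) nmulA.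
by rewrite -[X in _ - X = _]addrA addrACA opprD [LHS]addrACA subrr addr0.
Qed.

End LocalUnit.

End CommutingUnits.

(** * Finitely generated subalgebras stable under the lifts *)

Definition generated (K : fieldType) (R : nalgType K) (X : seq R) (x : R) : Prop :=
  forall S, is_subalg S -> (forall y, y \in X -> S y) -> S x.

Section Generated.
Variables (K : fieldType) (R : nalgType K) (X : seq R).
Local Notation "x ** y" := (nmul R x y) (at level 40, left associativity).

Lemma generated_subalg : is_subalg (generated X).
Proof.
split; first split.
- by move=> S [[]].
- by move=> x y Nx Ny S algS XS; case: (algS) => -[_ SD _] _; apply: SD; [apply: Nx | apply: Ny].
- by move=> k x Nx S algS XS; case: (algS) => -[_ _ SZ] _; apply: SZ; apply: Nx.
- by move=> x y Nx Ny S algS XS; case: (algS) => _ SM; apply: SM; [apply: Nx | apply: Ny].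
Qed.

Lemma generated_mem x : x \in X -> generated X x.
Proof. by move=> Xx S _; apply. Qed.

Lemma generated_l a : (forall x, x \in X -> generated X (a ** x)) ->
  forall x, generated X x -> generated X (a ** x).
Proof.
move=> aX x Nx; have [[N0 ND NZ] NM] := generated_subalg.
pose S y := generated X y /\ generated X (a ** y).
suff [] : S x by [].
apply: Nx => [|y Xy]; last by split; [apply: generated_mem | apply: aX].
split; first split.
- by split=> //; rewrite (alg_mul0 (nalg_law R)).
- by move=> y z [Ny ay] [Nz az]; split; [apply: ND | rewrite nmulDr; apply: ND].
- by move=> k y [Ny ay]; split; [apply: NZ | rewrite nmulZr; apply: NZ].
- by move=> y z [Ny ay] [Nz _]; split; [apply: NM | rewrite nmulA; apply: NM].
Qed.

Lemma generated_r a : (forall x, x \in X -> generated X (x ** a)) ->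
  forall x, generated X x -> generated X (x ** a).
Proof.
move=> aX x Nx; have [[N0 ND NZ] NM] := generated_subalg.
pose S y := generated X y /\ generated X (y ** a).
suff [] : S x by [].
apply: Nx => [|y Xy]; last by split; [apply: generated_mem | apply: aX].
split; first split.
- by split=> //; rewrite (alg_0mul (nalg_law R)).
- by move=> y z [Ny ay] [Nz az]; split; [apply: ND | rewrite nmulDl; apply: ND].
- by move=> k y [Ny ay]; split; [apply: NZ | rewrite nmulZl; apply: NZ].
- by move=> y z [Ny ay] [Nz az]; split; [apply: NM | rewrite -nmulA; apply: NM].
Qed.

End Generated.

(* The generators are the defects of multiplicativity of [v |-> comb r v] and the
   elements of [H], together with their one- and two-sided multiples by [r]. *)
Lemma stable_finite_generation (K : fieldType) (R : nalgType K) (J : R -> Prop) n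
    (r : 'I_n -> R) (c : 'I_n -> 'I_n -> 'rV[K]_n) (H : seq R) :
    is_ideal J -> (forall x, x \in H -> J x) ->
    (forall i j, J (nmul R (r i) (r j) - comb r (c i j))) ->
  exists X : seq R, [/\ forall x, x \in X -> J x,
    forall x, x \in H -> generated X x,
    forall i j, generated X (nmul R (r i) (r j) - comb r (c i j)),
    forall i x, generated X x -> generated X (nmul R (r i) x) &
    forall i x, generated X x -> generated X (nmul R x (r i))].
Proof.
move=> [subJ _ Jl Jr] HJ defJ.
pose d i j := nmul R (r i) (r j) - comb r (c i j).
pose Y := H ++ [seq d i j | i <- enum 'I_n, j <- enum 'I_n].
pose rs := [seq r i | i <- enum 'I_n].
pose Z := [seq nmul R a y | a <- rs, y <- Y].
pose X := Y ++ Z ++ [seq nmul R y a | y <- Y, a <- rs]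
            ++ [seq nmul R z a | z <- Z, a <- rs].
have rs_r i : r i \in rs by rewrite map_f ?mem_enum.
have YJ y : y \in Y -> J y.
  by rewrite mem_cat => /orP[/HJ //|/allpairsP[[i j] [_ _ ->]]]; apply: defJ.
have ZJ z : z \in Z -> J z by case/allpairsP=> [[a y] [_ /YJ Jy ->]]; apply: Jl.
have mem4 (s1 s2 s3 s4 : seq R) x : (x \in s1 ++ s2 ++ s3 ++ s4)
    = [|| x \in s1, x \in s2, x \in s3 | x \in s4] by rewrite !mem_cat.
have XJ x : x \in X -> J x.
  rewrite mem4 => /or4P[/YJ //|/ZJ //||]; case/allpairsP=> [[y a] [/= yP _ ->]].
    by apply: Jr => //; apply: YJ.
  by apply: Jr => //; apply: ZJ.
pose N := generated X; have [subN NM] : is_subalg N := generated_subalg X.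
have NY y : y \in Y -> N y by move=> Yy; apply: generated_mem; rewrite mem4 Yy.
have Nry i y : y \in Y -> N (nmul R (r i) y).
  move=> Yy; apply: generated_mem; rewrite mem4; apply/or4P/Or42.
  exact: allpairs_f.
have Nyr i y : y \in Y -> N (nmul R y (r i)).
  move=> Yy; apply: generated_mem; rewrite mem4; apply/or4P/Or43.
  exact: allpairs_f.
have Nryr i j y : y \in Y -> N (nmul R (nmul R (r i) y) (r j)).
  move=> Yy; apply: generated_mem; rewrite mem4; apply/or4P/Or44.
  by apply: allpairs_f => //; apply: allpairs_f.
have Nd i j : N (d i j).
  by apply: NY; rewrite mem_cat; apply/orP; right; apply: allpairs_f; rewrite mem_enum.
have rrE i j : nmul R (r i) (r j) = comb r (c i j) + d i j by rewrite addrC subrK.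
(* A double multiple reduces to single ones: [r i r j] is a combination of the [r k] up to the
   defect [d i j], which is in [N]. *)
have Nrr i j y : N y -> (forall k, N (nmul R (r k) y)) ->
    N (nmul R (r i) (nmul R (r j) y)).
  move=> Ny Nry'; rewrite nmulA rrE nmulDl; case: (subN) => _ ND NZ; apply: ND.
    rewrite (alg_mul_suml (nalg_law R)); apply: (subspace_sum _ subN) => k.
    by rewrite nmulZl; apply: NZ.
  exact: NM.
have Nrr' i j y : N y -> (forall k, N (nmul R y (r k))) ->
    N (nmul R (nmul R y (r j)) (r i)).
  move=> Ny Nry'; rewrite -nmulA rrE nmulDr; case: (subN) => _ ND NZ; apply: ND.
    rewrite (alg_mul_sumr (nalg_law R)); apply: (subspace_sum _ subN) => k.
    by rewrite nmulZr; apply: NZ.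
  exact: NM.
exists X; split=> //.
- by move=> x Hx; apply: NY; rewrite mem_cat Hx.
- move=> i; apply: generated_l => x; rewrite mem4 => /or4P[Yx|||].
  + exact: Nry.
  + case/allpairsP=> [[_ y] [/mapP[j _ ->] /= Yy ->]]; apply: Nrr; first exact: NY.
    by move=> k; apply: Nry.
  + case/allpairsP=> [[y _] [/= Yy /mapP[j _ ->] ->]]; rewrite nmulA; exact: Nryr.
  + case/allpairsP=> [[z _] [/= /allpairsP[[_ y] [/mapP[j _ ->] /= Yy ->]] /mapP[k _ ->] ->]].
    rewrite -nmulA; apply: Nrr; first exact: Nyr.
    by move=> l; rewrite nmulA; apply: Nryr.
- move=> i; apply: generated_r => x; rewrite mem4 => /or4P[Yx|||].
  + exact: Nyr.
  + by case/allpairsP=> [[_ y] [/mapP[j _ ->] /= Yy ->]]; apply: Nryr.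
  + case/allpairsP=> [[y _] [/= Yy /mapP[j _ ->] ->]]; apply: Nrr'; first exact: NY.
    by move=> k; apply: Nyr.
  + case/allpairsP=> [[z _] [/= /allpairsP[[_ y] [/mapP[j _ ->] /= Yy ->]] /mapP[k _ ->] ->]].
    by apply: Nrr'; [apply: Nry | move=> l; apply: Nryr].
Qed.

(** * Assembling the subalgebra of [R] *)

Unset Implicit Arguments.

(* R/J is represented by any K-algebra Q together with a surjective K-algebra
   homomorphism pi : R -> Q whose kernel is exactly J (Q is then R/J up to
   isomorphism). *)
Theorem theorem4p6 (K : fieldType) (R : nalgType K) (J : R -> Prop)
    (Q : nalgType K) (pi : R -> Q) :
  perfect_field K ->
  is_ideal J ->
  nalg_hom pi ->
  (forall q : Q, exists r : R, pi r = q) ->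
  (forall r : R, pi r = 0 <-> J r) ->
  locally_fdss_in J ->
  locally_fdss Q ->
  locally_fdss R.
Proof.
move=> perfK idJ [piD piZ piM] pi_surj piJ lfJ lfQ fs _.
have law := nalg_law R.
have pi0 : pi 0 = 0 by rewrite -(scale0r 0) piZ scale0r.
have piB x y : pi (x - y) = pi x - pi y by rewrite -scaleN1r piD piZ scaleN1r.
have [_ _ Jl Jr] := idJ.
have [S [fdS _ fsS]] := lfQ [seq pi f | f <- fs] (fun _ _ => I).
have [algS _ ssS] := fdS; have spS := semisimple_semiprime algS ssS.
have [n [b [mul [mulP spV bP b_free mulE]]]] := fdss_coordinates fdS.
have /fin_all_exists[r rP] := fun i => pi_surj (b i).
have pi_comb v : pi (comb r v) = comb b v.
  rewrite /comb (big_morph _ piD pi0); apply: eq_bigr => i _.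
  by rewrite piZ rP.
pose c i j := mul (delta_mx 0 i) (delta_mx 0 j).
have /fin_all_exists[v vP] : forall k : 'I_(size fs), exists v, pi (fs`_k) = comb b v.
  by move=> k; apply/bP/fsS/map_f/mem_nth.
pose H := [seq fs`_k - comb r (v k) | k : 'I_(size fs) <- enum 'I_(size fs)].
have [||X [XJ HN defN Nl Nr]] := @stable_finite_generation K R J n r c H idJ.
- by move=> _ /mapP[k _ ->]; apply/piJ; rewrite piB vP pi_comb subrr.
- by move=> i j; apply/piJ; rewrite piB piM !rP pi_comb mulE !comb_delta subrr.
pose N := generated X; have [subN NM] : is_subalg N := generated_subalg X.
have [T0 [fdT0 T0J XT0]] := lfJ X XJ.
have [e T0e eP] := fdss_unit fdT0.
have NT (T : R -> Prop) : is_subalg T -> (forall x, x \in X -> T x) -> forall x, N x -> T x.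
  by move=> algT XT x; apply.
have NT0 : forall x, N x -> T0 x by apply: NT => //; case: fdT0.
have [q [Jq qN qr]] : exists q, [/\ J q,
    forall x, N x -> nmul R q x = x /\ nmul R x q = x &
    forall i, nmul R (r i) q = nmul R q (r i)].
  apply: (commuting_local_unit perfK mulP spV idJ (T0J e T0e) subN) => //.
  - by move=> x /NT0/T0J.
  - by move=> x /NT0/eP.
(* [q] need not be idempotent; Fitting's construction in [T1] replaces it by an idempotent [p] that
   still commutes with the [r i] and is a unit on [N]. *)
have [T1 [fdT1 T1J qT1]] : exists T1,
    [/\ fdss_subalg T1, forall x, T1 x -> J x & forall x, x \in [:: q] -> T1 x].
  by apply: lfJ => x; rewrite inE => /eqP->.
have [p [T1p pp pC pl pr]] := fitting_idempotent fdT1 (qT1 q (mem_head _ _)).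
have pr_r i : nmul R (r i) p = nmul R p (r i) by apply/pC/qr.
have pN x : N x -> nmul R p x = x /\ nmul R x p = x.
  by move=> /qN[qx xq]; split; [apply: pl | apply: pr].
(* The elements [r i p] are included because [r i x = (r i p) x] when [p x = x], which will keep the
   corner stable. *)
have [T2 [fdT2 T2J XT2]] : exists T2, [/\ fdss_subalg T2, forall x, T2 x -> J x &
    forall x, x \in p :: [seq nmul R (r i) p | i <- enum 'I_n] ++ X -> T2 x].
  apply: lfJ => x; rewrite inE mem_cat => /or3P[/eqP->|/mapP[i _ ->]|/XJ //].
    exact: T1J.
  by apply: Jl => //; apply: T1J.
have T2p : T2 p by apply: XT2; rewrite mem_head.
have T2r i : T2 (nmul R (r i) p).
  by apply: XT2; rewrite inE mem_cat; apply/or3P/Or32/mapP; exists i; rewrite ?mem_enum.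
have [algT2 [tl tlP] ssT2] := fdT2; have spT2 := semisimple_semiprime algT2 ssT2.
have NT2 : forall x, N x -> T2 x.
  by apply: NT => // x Xx; apply: XT2; rewrite inE mem_cat Xx !orbT.
case: (algT2) => [[T20 T2D T2Z] T2M].
(* The corner [p T2 p] absorbs the [r i] since [p] commutes with them. *)
pose T x := [/\ T2 x, nmul R p x = x & nmul R x p = x].
have T0' : T 0 by rewrite /T (alg_mul0 law) (alg_0mul law).
have TD x y : T x -> T y -> T (x + y).
  by move=> [Tx px xp] [Ty py yp];
    split; [apply: T2D | rewrite nmulDr px py | rewrite nmulDl xp yp].
have TZ k x : T x -> T (k *: x).
  by move=> [Tx px xp]; split; [apply: T2Z | rewrite nmulZr px | rewrite nmulZl xp].
have TM x y : T x -> T y -> T (nmul R x y).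
  by move=> [Tx px xp] [Ty py yp]; split; [apply: T2M | rewrite nmulA px | rewrite -nmulA yp].
have subT : is_subspace T by split.
have Tl i x : T x -> T (nmul R (r i) x).
  move=> [Tx px xp]; split; last by rewrite -nmulA xp.
    by rewrite -px nmulA; apply: T2M.
  by rewrite nmulA -pr_r -nmulA px.
have Tr i x : T x -> T (nmul R x (r i)).
  move=> [Tx px xp]; split; last by rewrite -nmulA pr_r nmulA xp.
    by rewrite -xp -nmulA -pr_r; apply: T2M.
  by rewrite nmulA px.
have NsubT x : N x -> T x by move=> Nx; have [px xp] := pN x Nx; split=> //; apply: NT2.
have combTl w x : T x -> T (nmul R (comb r w) x).
  move=> Tx; rewrite (alg_mul_suml law); apply: subspace_sum => // i.
  by rewrite nmulZl; apply/TZ/Tl.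
have combTr w x : T x -> T (nmul R x (comb r w)).
  move=> Tx; rewrite (alg_mul_sumr law); apply: subspace_sum => // i.
  by rewrite nmulZr; apply/TZ/Tr.
pose B x := exists w t, T t /\ x = comb r w + t.
have BT x : T x -> B x by move=> Tx; exists 0, x; rewrite comb0 add0r.
have Br w : B (comb r w) by exists w, 0; rewrite addr0.
have subB : is_subspace B.
  split; first exact: BT.
    move=> _ _ [w [t [Tt ->]]] [w' [t' [Tt' ->]]]; exists (w + w'), (t + t').
    by split; [apply: TD | rewrite combD addrACA].
  move=> k _ [w [t [Tt ->]]]; exists (k *: w), (k *: t).
  by split; [apply: TZ | rewrite combZ scalerDr].
have algB : is_subalg B.
  split=> // _ _ [w [t [Tt ->]]] [w' [t' [Tt' ->]]].
  have Tww : T (nmul R (comb r w) (comb r w') - comb r (mul w w')).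
    by apply: NsubT; apply: comb_mul.
  exists (mul w w'), (nmul R (comb r w) (comb r w') - comb r (mul w w')
    + nmul R (comb r w) t' + nmul R t (comb r w' + t')).
  split; last by rewrite nmulDl nmulDr !addrA (addrC (comb r (mul w w'))) addrK.
  apply: (TD _ _); first by apply: (TD _ _) => //; apply: combTl.
  by rewrite nmulDr; apply: (TD _ _); [apply: combTr | apply: TM].
exists B; split=> //.
  split=> //.
    (* As [tl] spans [T2], the compressed elements [p t p] span the corner. *)
    exists ([seq r i | i <- enum 'I_n] ++ [seq nmul R (nmul R p t) p | t <- tl]) => x.
    set s := _ ++ _; have subs := in_span_subspace s; split; last first.
      apply: in_span_min => // y; rewrite mem_cat => /orP[/mapP[i _ ->]|/mapP[t tt ->]].
        by rewrite -(comb_delta r i).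
      have T2t : T2 t by apply/tlP/in_span_mem.
      apply: BT; split; first by apply: (T2M _ _) => //; apply: T2M.
        by rewrite !nmulA pp.
      by rewrite -nmulA pp.
    move=> [w [t [[/tlP tt pt tp] ->]]]; case: (subs) => s0 sD sZ; apply: (sD _ _).
      apply: subspace_comb => // i; apply: in_span_mem.
      by rewrite mem_cat map_f ?mem_enum.
    rewrite -pt -tp nmulA.
    apply: (@in_span_min _ _ tl (fun y => in_span s (nmul R (nmul R p y) p))) tt => [|y yt].
      split; first by rewrite (alg_mul0 law) (alg_0mul law).
        by move=> y z sy sz; rewrite nmulDr nmulDl; apply: sD.
      by move=> k y sy; rewrite nmulZr nmulZl; apply: sZ.
    by apply: in_span_mem; rewrite mem_cat (map_f (fun t => _)) ?orbT.
  apply: semiprime_semisimple => // x [w [t [Tt xE]]] xx.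
  have piT y : T y -> pi y = 0 by case=> /T2J /piJ.
  (* Applying [pi] to [x B x = 0] gives the same relation for [pi x] in [S], so [pi x = 0] by
     semiprimeness of [S]. *)
  have w0 : w = 0.
    apply: b_free; have pix : pi x = comb b w by rewrite xE piD pi_comb piT // addr0.
    rewrite -pix; apply: spS; first by rewrite pix; apply/bP; exists w.
    by move=> _ /bP[w' ->]; rewrite -pi_comb -!piM xx.
  have {w0} xt : x = t by rewrite xE w0 comb0 add0r.
  have [T2x px xp] : T x by rewrite xt.
  (* For [y] in [T2], [x y x = x (p y p) x], and [p y p] is in the corner, hence in [B]. *)
  apply: spT2 => // y T2y.
  have := xx (nmul R (nmul R p y) p); rewrite !nmulA xp -(nmulA _ p x) px; apply.
  apply: BT; split; first by apply: (T2M _ _) => //; apply: T2M.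
    by rewrite !nmulA pp.
  by rewrite -nmulA pp.
move=> f ff; have lt_f : (index f fs < size fs)%N by rewrite index_mem.
pose k := Ordinal lt_f; exists (v k), (fs`_k - comb r (v k)); split.
  by apply: NsubT; apply: HN; apply/mapP; exists k; rewrite ?mem_enum.
by rewrite addrC subrK nth_index.
Qed.
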